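(* Let $c\in(0,3]$. For $f\in\mathcal{A}$ with $f'$ nonvanishing on $\mathbb{D}$, the following are equivalent: (i) $f\in\mathcal{F}(c)$; (ii) for all $z\in\mathbb{D}$, $$\operatorname{Re}\left(1+\frac{zf''(z)}{f'(z)}\right)\geq 1-\frac{c}{2}+\left(\frac{1-|z|^2}{2c}\right)\left|\frac{zf''(z)}{f'(z)}\right|^2;$$ (iii) for all $z\in\mathbb{D}$, $$\left|(1-|z|^2)\left(\frac{f''(z)}{f'(z)}\right)-c\bar z\right|\leq c.$$ The inequalities (ii) and (iii) are both sharp for the function $$f_c(z)=\frac{(1-z)^{1-c}-1}{c-1}\quad\text{for } z\in\mathbb{D},\ \text{with } c\in(0,3].$$
   Context: $\mathbb{D}=\{z\in\mathbb{C}:|z|<1\}$. $\mathcal{A}$ is the class of analytic functions $f$ on $\mathbb{D}$ with $f(0)=0$ and $f'(0)=1$. For $c\in(0,3]$, $\mathcal{F}(c)$ is the class of $f\in\mathcal{A}$ such that $\operatorname{Re}\left(1+\frac{zf''(z)}{f'(z)}\right)>1-\frac{c}{2}$ for all $z\in\mathbb{D}$. For $c=1$ the formula for $f_c$ is read as its limit $-\log(1-z)$. *)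

(* Defs.v *)
From Stdlib Require Export Reals.
From Coquelicot Require Export Coquelicot.

Open Scope R_scope.

Definition unit_disk (z : C) : Prop := Cmod z < 1.

Definition analytic_at (f : C -> C) (z0 : C) : Prop :=
  exists (r : posreal) (a : nat -> C),
    forall z : C, Cmod (z - z0)%C < r ->
      is_pseries (K := C_AbsRing) (V := C_NormedModule) a (z - z0)%C (f z).

Definition analytic_on (U : C -> Prop) (f : C -> C) : Prop :=
  forall z : C, U z -> analytic_at f z.

(** Functions on the disk are represented by total functions [C -> C]; their
    values outside the disk play no role.  [C_derive] is a limit of difference
    quotients along real increments; it is the complex derivative wherever that
    exists, hence throughout the disk for the functions (and the derivatives)
    considered here. *)
Definition class_A (f : C -> C) : Prop :=
  analytic_on unit_disk f /\ f (RtoC 0) = RtoC 0 /\ C_derive f (RtoC 0) = RtoC 1.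

Definition nonvanishing_deriv (f : C -> C) : Prop :=
  forall z : C, unit_disk z -> C_derive f z <> RtoC 0.

(** [f'' / f'] *)
Definition pre_schwarzian (f : C -> C) (z : C) : C :=
  (C_derive (C_derive f) z / C_derive f z)%C.

(** Division in [C] is total, so the requirement that [f'' / f'] make sense on
    the disk, implicit in the defining inequality, has to be written out. *)
Definition class_F (c : R) (f : C -> C) : Prop :=
  class_A f /\ nonvanishing_deriv f /\
  forall z : C, unit_disk z ->
    Re (1 + z * pre_schwarzian f z)%C > 1 - c / 2.

(** Principal argument, with values in (-PI, PI]; the value at 0 is junk. *)
Definition Carg (z : C) : R :=
  if Rlt_dec 0 (Re z) then atan (Im z / Re z)
  else if Rlt_dec 0 (Im z) then PI / 2 - atan (Re z / Im z)
  else if Rlt_dec (Im z) 0 then - (PI / 2) - atan (Re z / Im z)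
  else PI.

Definition Clog (z : C) : C := (ln (Cmod z), Carg z).

Definition Cexp (z : C) : C := (exp (Re z) * cos (Im z), exp (Re z) * sin (Im z)).

(** Principal branch of [w ^ a] for a real exponent [a] and [w <> 0]. *)
Definition Crpow (w : C) (a : R) : C := Cexp (RtoC a * Clog w)%C.

Definition f_extremal (c : R) (z : C) : C :=
  if Req_EM_T c 1 then (- Clog (1 - z))%C
  else ((Crpow (1 - z) (1 - c) - 1) / RtoC (c - 1))%C.

(* Main.v *)
(* With [p = f'' / f'], expanding squared moduli turns (iii) into [|p| <= |c + z p|], while
   membership in [F(c)] says [|z p| < |c + z p|].  The function [w = p / (c + z p)] is analytic
   on the disk, and [|z w| < 1] there forces [|w| <= 1] by Schwarz' lemma, so (i) implies (iii).
   Squaring [|p| <= |c + z p|] once more and using [|z p| <= |p|] gives (ii), and (ii) implies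
   (i) because its last term is positive unless [z p = 0].

   For [f_c] one has [f_c' = (1 - z)^(-c)] and [f_c'' / f_c' = c / (1 - z)]; the constants in
   (ii) cannot be improved, as [z -> -1] and [z -> 1] along the real axis show. *)

Require Import Defs.
From Stdlib Require Import Reals Lra Lia List Classical ClassicalEpsilon.
From Coquelicot Require Import Coquelicot.

(** At a fixed [z], (iii) implies (ii) and (ii) implies the inequality of (i), by algebra alone. The
    way back is not pointwise: (ii) carries an extra factor [|z|^2], and only Schwarz' lemma,
    applied on the whole disk, recovers it.

    The obstacle is that analyticity means a convergent power series about each point, a notion for
    which quotients are laborious. So [w] is never formed: its numerator and denominator are
    multiplied by [f'], which gives [A = f''] and [B = c f' + z f''], both analytic through linear
    operations and index shifts, and Schwarz' lemma is stated as a comparison of [|A|] with [|B|].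
    Its maximum principle rests on the first nonzero Taylor coefficient of [A - q B], with no
    integration.

    The same notion asks for a series of [f_c] about every point of the disk, not just about 0.
    Binomial series give this for the powers of [1 - z]; termwise integration of the series for
    [f_c'] then treats [c = 1] and the other cases alike. *)

Local Notation is_Cseries := (is_series (K := C_AbsRing) (V := C_NormedModule)).
Local Notation is_Cpseries := (is_pseries (K := C_AbsRing) (V := C_NormedModule)).

(** * Complex power series and a quadratic Taylor estimate *)

Lemma is_series_Cmod_le (a : nat -> C) (b : nat -> R) (l : C) (s : R) :
  is_Cseries a l -> is_series b s ->
  (forall n, Cmod (a n) <= b n) -> Cmod l <= s.
Proof.
  intros Ha Hb Hab.
  apply (is_lim_seq_le (fun n => Cmod (sum_n (G := C_AbelianMonoid) a n)) (sum_n b) (Cmod l) s).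
  - intros n. induction n as [|n IH].
    + rewrite !sum_O. apply Hab.
    + rewrite !sum_Sn. eapply Rle_trans; [apply Cmod_triangle|].
      apply Rplus_le_compat; [exact IH|apply Hab].
  - exact (filterlim_comp _ _ _ _ _ _ _ _ Ha (filterlim_norm (V := C_NormedModule) l)).
  - exact Hb.
Qed.

Lemma is_pseries_C (a : nat -> C) (h l : C) :
  is_Cpseries a h l <->
  is_Cseries (fun n => Cmult (Cpow h n) (a n)) l.
Proof. reflexivity. Qed.

Definition converges_on_disk (a : nat -> C) (r : R) : Prop :=
  forall h : C, Cmod h < r ->
    ex_pseries (K := C_AbsRing) (V := C_NormedModule) a h.

Lemma is_series_terms_bounded (a : nat -> C) (l : C) :
  is_Cseries a l ->
  exists M, forall n, Cmod (a n) <= M.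
Proof.
  intros Ha.
  destruct (filterlim_bounded (K := C_AbsRing) (V := C_NormedModule) _ (ex_intro _ l Ha)) as [M HM].
  exists (M + M). intros [|n].
  - assert (H := HM 0%nat). rewrite sum_O in H.
    assert (H' : Cmod (a 0%nat) <= M) by exact H.
    assert (H'' := Cmod_ge_0 (a 0%nat)). lra.
  - assert (H1 : Cmod (sum_n (G := C_AbelianMonoid) a n) <= M) by exact (HM n).
    assert (H2 : Cmod (sum_n (G := C_AbelianMonoid) a (S n)) <= M) by exact (HM (S n)).
    rewrite sum_Sn in H2.
    set (x := sum_n (G := C_AbelianMonoid) a n) in *.
    change (Cmod (x + a (S n))%C <= M) in H2.
    replace (a (S n)) with ((x + a (S n)) + - x)%C by ring.
    eapply Rle_trans; [apply Cmod_triangle|]. rewrite Cmod_opp. lra.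
Qed.

(** Convergence at a real point [s < r] bounds the terms [|a n| s^n], so the radius is at least [s];
    then [s] tends to [r]. This hands questions of absolute convergence to the real theory of power
    series. *)
Lemma CV_radius_Cmod_ge (a : nat -> C) (r : R) :
  converges_on_disk a r -> Rbar_le r (CV_radius (fun n => Cmod (a n))).
Proof.
  intros Ha.
  assert (Hs : forall s, 0 <= s < r -> Rbar_le s (CV_radius (fun n => Cmod (a n)))).
  { intros s Hs. apply (proj1 (CV_radius_bounded _)).
    destruct (Ha (RtoC s)) as [l Hl].
    { rewrite Cmod_R, Rabs_pos_eq; lra. }
    apply is_pseries_C, is_series_terms_bounded in Hl. destruct Hl as [M HM].
    exists M. intros n. eapply Rle_trans; [|apply (HM n)].
    rewrite Cmod_mult, Cmod_pow, Cmod_R, Rabs_mult, <- RPow_abs, (Rabs_pos_eq (Cmod _)).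
    - lra.
    - apply Cmod_ge_0. }
  assert (H0 := CV_radius_ge_0 (fun n => Cmod (a n))).
  destruct (CV_radius (fun n => Cmod (a n))) as [R0| |]; simpl in *; auto.
  apply Rnot_lt_le; intros Hlt.
  assert (H := Hs ((R0 + r) / 2)). lra.
Qed.

Lemma ex_series_Cmod (a : nat -> C) (b : nat -> R) :
  (forall n, Cmod (a n) <= b n) -> ex_series b ->
  ex_series (K := C_AbsRing) (V := C_NormedModule) a.
Proof. apply (ex_series_le (V := C_CompleteNormedModule)). Qed.

Lemma converges_on_disk_CV_radius (a : nat -> C) (b : nat -> R) (r : R) :
  (forall n, Cmod (a n) <= b n) -> Rbar_le r (CV_radius b) -> converges_on_disk a r.
Proof.
  intros Hab Hr h Hh.
  apply (ex_series_Cmod (fun n => Cmult (Cpow h n) (a n)) (fun n => Rabs (b n * Cmod h ^ n))).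
  - intros n. rewrite Cmod_mult, Cmod_pow, Rmult_comm.
    eapply Rle_trans; [|apply Rle_abs].
    apply Rmult_le_compat_r; [apply pow_le, Cmod_ge_0|apply Hab].
  - apply CV_disk_inside.
    apply Rbar_lt_le_trans with (2 := Hr).
    rewrite Rabs_pos_eq by apply Cmod_ge_0. exact Hh.
Qed.

Definition Cderiv_coeff (a : nat -> C) (n : nat) : C := (RtoC (INR (S n)) * a (S n))%C.

Lemma converges_on_disk_derive (a : nat -> C) (r : R) :
  converges_on_disk a r -> converges_on_disk (Cderiv_coeff a) r.
Proof.
  intros Ha.
  apply converges_on_disk_CV_radius with (PS_derive (fun n => Cmod (a n))).
  - intros n. unfold Cderiv_coeff, PS_derive.
    rewrite Cmod_mult, Cmod_R, Rabs_pos_eq by apply pos_INR. apply Rle_refl.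
  - rewrite CV_radius_derive. now apply CV_radius_Cmod_ge.
Qed.

(** Multiplying the n-th coefficient by [n] is the operator [x d/dx], called [D] below, and it
    preserves the radius of convergence. Two applications produce the weight [n^2] of the Taylor
    remainder. *)
Lemma ex_series_square_weighted (a : nat -> C) (r rho : R) :
  converges_on_disk a r -> 0 <= rho < r ->
  ex_series (fun n => INR n ^ 2 * (Cmod (a n) * rho ^ n)).
Proof.
  intros Ha Hrho.
  set (D := fun b : nat -> R => PS_incr_1 (PS_derive b)).
  assert (HD : forall b n, D b n = INR n * b n).
  { intros b [|n]; [symmetry; exact (Rmult_0_l _)|reflexivity]. }
  apply ex_series_ext with (fun n => Rabs (D (D (fun n => Cmod (a n))) n * rho ^ n)).
  { intros n. rewrite !HD, Rabs_pos_eq;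
      [match goal with |- ?x = ?y => change (@eq R x y) end; ring|].
    apply Rmult_le_pos; [|apply pow_le; lra].
    repeat apply Rmult_le_pos; try apply pos_INR; apply Cmod_ge_0. }
  apply CV_disk_inside. unfold D.
  rewrite !CV_radius_incr_1, CV_radius_derive, CV_radius_incr_1, CV_radius_derive.
  apply Rbar_lt_le_trans with (2 := CV_radius_Cmod_ge a r Ha).
  simpl. rewrite Rabs_pos_eq; lra.
Qed.

(** The remainder [e_n] satisfies [e_(n+1) = (z + h) e_n + n h^2 z^(n-1)], so the constants grow
    like [n^2 + n <= (n + 1)^2]. The factor [rho^2] on the left stands in for the exponent [n - 2]
    on the right, which natural numbers would truncate. *)
Lemma Cpow_taylor_bound (z h : C) (rho : R) (n : nat) :
  Cmod z <= rho -> Cmod z + Cmod h <= rho ->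
  rho ^ 2 * Cmod ((z + h) ^ n - z ^ n - RtoC (INR n) * h * z ^ pred n)%C
  <= INR n ^ 2 * Cmod h ^ 2 * rho ^ n.
Proof.
  intros Hz Hzh.
  assert (Hz0 := Cmod_ge_0 z). assert (Hh0 := Cmod_ge_0 h).
  assert (Hrho : 0 <= rho) by lra.
  induction n as [|n IH].
  - replace ((z + h) ^ 0 - z ^ 0 - RtoC (INR 0) * h * z ^ pred 0)%C with (RtoC 0)
      by (simpl; ring).
    rewrite Cmod_0. simpl. lra.
  - set (e := ((z + h) ^ n - z ^ n - RtoC (INR n) * h * z ^ pred n)%C) in *.
    assert (He : ((z + h) ^ S n - z ^ S n - RtoC (INR (S n)) * h * z ^ pred (S n)
                  = (z + h) * e + RtoC (INR n) * (h * h * z ^ pred n))%C).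
    { unfold e. destruct n as [|n]; [simpl; ring|].
      rewrite (S_INR (S n)), RtoC_plus. cbn [pred]. rewrite !Cpow_S. ring. }
    rewrite He.
    eapply Rle_trans.
    { apply Rmult_le_compat_l; [nra|]. apply Cmod_triangle. }
    rewrite !Cmod_mult, Cmod_R, (Rabs_pos_eq (INR n)) by apply pos_INR.
    rewrite Rmult_plus_distr_l.
    assert (H1 : rho ^ 2 * (Cmod (z + h)%C * Cmod e) <= rho * (INR n ^ 2 * Cmod h ^ 2 * rho ^ n)).
    { replace (rho ^ 2 * (Cmod (z + h)%C * Cmod e)) with (Cmod (z + h)%C * (rho ^ 2 * Cmod e)) by ring.
      apply Rmult_le_compat; auto using Cmod_ge_0.
      - apply Rmult_le_pos; [nra|apply Cmod_ge_0].
      - eapply Rle_trans; [apply Cmod_triangle|lra]. }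
    assert (H2 : rho ^ 2 * (INR n * (Cmod h * Cmod h * Cmod (z ^ pred n)%C))
                 <= INR n * Cmod h ^ 2 * rho ^ S n).
    { destruct n as [|n]; [simpl; lra|]. cbn [pred].
      rewrite Cmod_pow.
      replace (INR (S n) * Cmod h ^ 2 * rho ^ S (S n))
        with (INR (S n) * Cmod h ^ 2 * rho ^ 2 * rho ^ n) by (simpl; ring).
      replace (rho ^ 2 * (INR (S n) * (Cmod h * Cmod h * Cmod z ^ n)))
        with (INR (S n) * Cmod h ^ 2 * rho ^ 2 * Cmod z ^ n) by ring.
      apply Rmult_le_compat_l.
      - repeat apply Rmult_le_pos; try apply pos_INR; try apply pow_le; lra.
      - apply pow_incr; lra. }
    replace (INR (S n) ^ 2) with (INR n ^ 2 + 2 * INR n + 1) by (rewrite S_INR; ring).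
    assert (H3 : 0 <= (INR n + 1) * (Cmod h ^ 2 * rho ^ S n)).
    { apply Rmult_le_pos; [pose proof (pos_INR n); lra|].
      apply Rmult_le_pos; apply pow_le; lra. }
    simpl pow in *. nra.
Qed.

Lemma is_Cseries_minus (a b : nat -> C) (la lb : C) :
  is_Cseries a la -> is_Cseries b lb -> is_Cseries (fun n => (a n - b n)%C) (la - lb)%C.
Proof. apply (is_series_minus (K := C_AbsRing) (V := C_NormedModule)). Qed.

(** The termwise remainders are summed at a radius [rho] midway between [|z|] and [r]. The quadratic
    error yields both directional derivatives and continuity later on. *)
Lemma is_Cpseries_taylor_bound (a : nat -> C) (r : R) (F : C -> C) (z d : C) :
  (forall h, Cmod h < r -> is_Cpseries a h (F h)) ->
  Cmod z < r -> is_Cpseries (Cderiv_coeff a) z d ->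
  exists K delta, 0 < delta /\
    forall h, Cmod h < delta -> Cmod (F (z + h) - F z - h * d)%C <= K * Cmod h ^ 2.
Proof.
  intros HF Hz HG.
  assert (Hz0 := Cmod_ge_0 z).
  set (rho := (Cmod z + r) / 2).
  assert (Hrho : Cmod z < rho < r) by (unfold rho; lra).
  destruct (ex_series_square_weighted a r rho) as [s Hs].
  { intros h Hh. eexists. apply HF, Hh. }
  { lra. }
  exists (s / rho ^ 2), (rho - Cmod z). split; [lra|].
  intros h Hh.
  assert (Hzh : Cmod (z + h)%C < r).
  { eapply Rle_lt_trans; [apply Cmod_triangle|lra]. }
  assert (H1 := proj1 (is_pseries_C _ _ _) (HF _ Hzh)).
  assert (H2 := proj1 (is_pseries_C _ _ _) (HF _ Hz)).
  assert (H3 := proj1 (is_pseries_C _ _ _) HG).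
  (* The derivative series is re-indexed to run parallel to the series of [F]; the added term at
     [n = 0] vanishes because of its factor [INR 0]. *)
  assert (H4 : is_Cseries
            (fun n => RtoC (INR n) * h * z ^ pred n * a n)%C (h * d)%C).
  { apply (is_series_decr_1 (K := C_AbsRing) (V := C_NormedModule)).
    apply (is_series_scal (K := C_AbsRing) (V := C_NormedModule) h) in H3.
    eapply is_series_ext in H3.
    2: { intros n.
         change (scal h (z ^ n * Cderiv_coeff a n)%C) with (h * (z ^ n * (RtoC (INR (S n)) * a (S n))))%C.
         replace (h * (z ^ n * (RtoC (INR (S n)) * a (S n))))%C
           with (RtoC (INR (S n)) * h * z ^ pred (S n) * a (S n))%C by (cbn [pred]; ring).
         reflexivity. }
    evar (l : C). replace (plus _ _) with l; [exact H3|]. unfold l.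
    change (h * d = h * d + - (RtoC 0 * h * z ^ pred 0 * a 0%nat))%C. ring. }
  assert (H5 := is_Cseries_minus _ _ _ _ (is_Cseries_minus _ _ _ _ H1 H2) H4).
  replace (s / rho ^ 2 * Cmod h ^ 2) with (Cmod h ^ 2 / rho ^ 2 * s) by (field; lra).
  refine (is_series_Cmod_le _ _ _ _ H5 (is_series_scal _ _ _ Hs) _).
  intros n.
  change (Cmod ((z + h) ^ n * a n - z ^ n * a n - RtoC (INR n) * h * z ^ pred n * a n)%C
          <= Cmod h ^ 2 / rho ^ 2 * (INR n ^ 2 * (Cmod (a n) * rho ^ n))).
  replace ((z + h) ^ n * a n - z ^ n * a n - RtoC (INR n) * h * z ^ pred n * a n)%C
    with (((z + h) ^ n - z ^ n - RtoC (INR n) * h * z ^ pred n) * a n)%C by ring.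
  rewrite Cmod_mult.
  assert (H6 := Cpow_taylor_bound z h rho n (Rlt_le _ _ (proj1 Hrho)) ltac:(lra)).
  replace (Cmod h ^ 2 / rho ^ 2 * (INR n ^ 2 * (Cmod (a n) * rho ^ n)))
    with (INR n ^ 2 * Cmod h ^ 2 * rho ^ n / rho ^ 2 * Cmod (a n)) by (field; lra).
  apply Rmult_le_compat_r; [apply Cmod_ge_0|].
  apply Rle_div_r; [nra|]. rewrite Rmult_comm. exact H6.
Qed.

(** * Directional differentiation *)

(* Only directional derivatives are recorded: that is what differentiating along rays requires,
   and for [Clog] and [Cexp] they reduce to real calculus on the components. *)
Definition has_deriv (F : C -> C) (z d : C) : Prop :=
  forall v : C,
    is_derive (fun t : R => Re (F (z + RtoC t * v)%C)) 0 (Re (v * d)%C) /\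
    is_derive (fun t : R => Im (F (z + RtoC t * v)%C)) 0 (Im (v * d)%C).

Lemma im_le_Cmod (z : C) : Rabs (Im z) <= Cmod z.
Proof.
  eapply Rle_trans; [|apply Rmax_Cmod]. apply Rmax_r.
Qed.

Lemma is_derive_quadratic (f : R -> R) (x l K delta : R) :
  0 < delta ->
  (forall t, Rabs t < delta -> Rabs (f (x + t) - f x - t * l) <= K * t ^ 2) ->
  is_derive f x l.
Proof.
  intros Hd Hf. apply is_derive_Reals. intros eps Heps.
  set (K' := Rabs K + 1).
  assert (HK : 0 < K') by (unfold K'; pose proof (Rabs_pos K); lra).
  assert (Hdel : 0 < Rmin delta (eps / K')).
  { apply Rmin_pos; [lra|apply Rdiv_lt_0_compat; lra]. }
  exists (mkposreal _ Hdel). simpl. intros h Hh Hlt.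
  assert (H1 := Hf h (Rlt_le_trans _ _ _ Hlt (Rmin_l _ _))).
  assert (H2 := Rlt_le_trans _ _ _ Hlt (Rmin_r _ _)).
  apply Rlt_div_r in H2; [|lra].
  replace ((f (x + h) - f x) / h - l) with ((f (x + h) - f x - h * l) / h) by (field; exact Hh).
  unfold Rdiv at 1. rewrite Rabs_mult, Rabs_inv.
  assert (Hh' : 0 < Rabs h) by (apply Rabs_pos_lt, Hh).
  apply (Rlt_div_l _ _ _ Hh').
  apply Rle_lt_trans with (1 := H1).
  rewrite <- (pow2_abs h).
  assert (HKK : K <= K') by (unfold K'; pose proof (Rle_abs K); lra).
  nra.
Qed.

Lemma has_deriv_quadratic (F : C -> C) (z d : C) (K delta : R) :
  0 < delta ->
  (forall h, Cmod h < delta -> Cmod (F (z + h) - F z - h * d)%C <= K * Cmod h ^ 2) ->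
  has_deriv F z d.
Proof.
  intros Hd HF v.
  assert (Hv := Cmod_ge_0 v).
  assert (Hd' : 0 < delta / (Cmod v + 1)) by (apply Rdiv_lt_0_compat; lra).
  assert (HB : forall t, Rabs t < delta / (Cmod v + 1) ->
    Cmod (F (z + RtoC (0 + t) * v) - F (z + RtoC 0 * v) - RtoC t * (v * d))%C
    <= K * Cmod v ^ 2 * t ^ 2).
  { intros t Ht. apply Rlt_div_r in Ht; [|lra].
    replace (z + RtoC 0 * v)%C with z by ring.
    rewrite Rplus_0_l.
    replace (RtoC t * (v * d))%C with (RtoC t * v * d)%C by ring.
    replace (K * Cmod v ^ 2 * t ^ 2) with (K * Cmod (RtoC t * v)%C ^ 2).
    - apply HF. rewrite Cmod_mult, Cmod_R. pose proof (Rabs_pos t). nra.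
    - rewrite Cmod_mult, Cmod_R, <- (pow2_abs t). ring. }
  split; apply is_derive_quadratic with (1 := Hd') (K := K * Cmod v ^ 2); intros t Ht;
    (eapply Rle_trans; [|apply (HB t Ht)]).
  - eapply Rle_trans; [|apply re_le_Cmod].
    apply Req_le. f_equal. generalize (v * d)%C (F (z + RtoC (0 + t) * v)%C) (F (z + RtoC 0 * v)%C).
    intros p q s. unfold Re, Im. simpl. ring.
  - eapply Rle_trans; [|apply im_le_Cmod].
    apply Req_le. f_equal. generalize (v * d)%C (F (z + RtoC (0 + t) * v)%C) (F (z + RtoC 0 * v)%C).
    intros p q s. unfold Re, Im. simpl. ring.
Qed.

Lemma is_derive_is_lim (g : R -> R) (l : R) (x : R) :
  is_derive (fun t => g (x + t)) 0 l -> is_lim (fun y => (g y - g x) / (y - x)) x l.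
Proof.
  intros Hg. apply is_derive_Reals in Hg.
  apply is_lim_spec. intros eps.
  destruct (Hg eps (cond_pos eps)) as [delta Hdelta].
  exists delta. intros y Hy Hyx.
  assert (H := Hdelta (y - x) ltac:(lra) Hy).
  rewrite Rplus_0_l, Rplus_minus in H.
  rewrite Rplus_0_r in H. exact H.
Qed.

(** [C_derive] takes real increments only, so the direction [v = 1] decides. *)
Lemma has_deriv_C_derive (F : C -> C) (z d : C) :
  has_deriv F z d -> C_derive F z = d.
Proof.
  intros HF. destruct (HF (RtoC 1)) as [H1 H2].
  assert (Hz : forall t : R, (z + RtoC t * RtoC 1)%C = (fst z + t, snd z)).
  { intros t. destruct z as [x y]. apply injective_projections; simpl; ring. }
  assert (Hq : forall y : R, ((F (y, snd z) - F z) / ((y, snd z) - z))%C =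
     ((Re (F (y, snd z)) - Re (F (fst z, snd z))) / (y - fst z),
      (Im (F (y, snd z)) - Im (F (fst z, snd z))) / (y - fst z))).
  { intros y. rewrite <- surjective_pairing.
    replace ((y, snd z) - z)%C with (RtoC (y - fst z)).
    - destruct (Req_dec (y - fst z) 0) as [H0|H0].
      (* At a zero increment both sides are 0 by the convention for division by zero, so [Hq] holds
         for every [y]. *)
      + unfold Cdiv. rewrite H0, Rdiv_0_r, Rdiv_0_r.
        replace (/ RtoC 0)%C with (RtoC 0) by (apply injective_projections; simpl; unfold Rdiv; ring).
        now rewrite Cmult_0_r.
      + generalize dependent (y - fst z). intros r Hr.
        generalize (F (y, snd z)) (F (fst z, snd z)). intros p q.
        apply injective_projections; unfold Re, Im; simpl; field; nra.
    - destruct z as [x0 y0]. apply injective_projections; simpl; ring. }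
  unfold C_derive, C_lim. rewrite (surjective_pairing d). f_equal.
  - assert (H : is_lim (fun y => fst ((F (y, snd z) - F z) / ((y, snd z) - z))%C) (fst z) (fst d)).
    { eapply is_lim_ext; [intros y; rewrite Hq; reflexivity|].
      apply (is_derive_is_lim (fun y => Re (F (y, snd z)))).
      rewrite Cmult_1_l in H1.
      eapply is_derive_ext; [|exact H1]. intros t. simpl. now rewrite Hz. }
    now rewrite (is_lim_unique _ _ _ H).
  - assert (H : is_lim (fun y => snd ((F (y, snd z) - F z) / ((y, snd z) - z))%C) (fst z) (snd d)).
    { eapply is_lim_ext; [intros y; rewrite Hq; reflexivity|].
      apply (is_derive_is_lim (fun y => Im (F (y, snd z)))).
      rewrite Cmult_1_l in H2.
      eapply is_derive_ext; [|exact H2]. intros t. simpl. now rewrite Hz. }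
    now rewrite (is_lim_unique _ _ _ H).
Qed.

Lemma has_deriv_ext_loc (F G : C -> C) (z d : C) (delta : R) :
  0 < delta -> (forall h, Cmod h < delta -> F (z + h)%C = G (z + h)%C) ->
  has_deriv F z d -> has_deriv G z d.
Proof.
  intros Hd HFG HF v. assert (Hv := Cmod_ge_0 v).
  assert (Hd' : 0 < delta / (Cmod v + 1)) by (apply Rdiv_lt_0_compat; lra).
  assert (Hloc : locally 0 (fun t : R => F (z + RtoC t * v)%C = G (z + RtoC t * v)%C)).
  { exists (mkposreal _ Hd'). intros t Ht. apply HFG.
    assert (Ht' : Rabs (t - 0) < delta / (Cmod v + 1)) by exact Ht.
    rewrite Rminus_0_r in Ht'. apply Rlt_div_r in Ht'; [|lra].
    rewrite Cmod_mult, Cmod_R. pose proof (Rabs_pos t). nra. }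
  destruct (HF v) as [H1 H2].
  split; (eapply is_derive_ext_loc; [|eassumption]);
    eapply filter_imp with (2 := Hloc); intros t Ht; simpl; now rewrite Ht.
Qed.

Lemma has_deriv_shift (F : C -> C) (z0 z d : C) :
  has_deriv (fun w => F (w - z0)%C) z d <-> has_deriv F (z - z0)%C d.
Proof.
  split; intros H v; destruct (H v) as [H1 H2]; split;
    (eapply is_derive_ext; [|eassumption]); intros t; simpl; do 2 f_equal; ring.
Qed.

Lemma has_deriv_plus (F G : C -> C) (z dF dG : C) :
  has_deriv F z dF -> has_deriv G z dG -> has_deriv (fun w => (F w + G w)%C) z (dF + dG)%C.
Proof.
  intros HF HG v. destruct (HF v) as [F1 F2], (HG v) as [G1 G2]. split.
  - replace (Re (v * (dF + dG))%C) with (Re (v * dF)%C + Re (v * dG)%C) by (simpl; ring).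
    exact (is_derive_plus _ _ _ _ _ F1 G1).
  - replace (Im (v * (dF + dG))%C) with (Im (v * dF)%C + Im (v * dG)%C) by (simpl; ring).
    exact (is_derive_plus _ _ _ _ _ F2 G2).
Qed.

Lemma has_deriv_const (k z : C) : has_deriv (fun _ => k) z 0.
Proof.
  intros v. rewrite Cmult_0_r. split.
  - exact (is_derive_const (Re k) 0).
  - exact (is_derive_const (Im k) 0).
Qed.

Lemma has_deriv_id (z : C) : has_deriv (fun w => w) z 1.
Proof.
  intros v. split; simpl; auto_derive; auto; ring.
Qed.

Lemma has_deriv_mult (F G : C -> C) (z dF dG : C) :
  has_deriv F z dF -> has_deriv G z dG ->
  has_deriv (fun w => (F w * G w)%C) z (dF * G z + F z * dG)%C.
Proof.
  intros HF HG v. destruct (HF v) as [F1 F2], (HG v) as [G1 G2].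
  assert (Hz : (z + RtoC 0 * v)%C = z) by ring.
  split.
  - assert (H := is_derive_minus _ _ _ _ _
      (is_derive_mult _ _ _ _ _ F1 G1 Rmult_comm) (is_derive_mult _ _ _ _ _ F2 G2 Rmult_comm)).
    cbv beta in H. rewrite !Hz in H.
    match type of H with is_derive _ _ ?l => replace (Re _) with l; [exact H|] end.
    unfold minus, plus, opp, mult, Re, Im; simpl; ring.
  - assert (H := is_derive_plus _ _ _ _ _
      (is_derive_mult _ _ _ _ _ F1 G2 Rmult_comm) (is_derive_mult _ _ _ _ _ F2 G1 Rmult_comm)).
    cbv beta in H. rewrite !Hz in H.
    match type of H with is_derive _ _ ?l => replace (Im _) with l; [exact H|] end.
    unfold plus, mult, Re, Im; simpl; ring.
Qed.

Lemma has_deriv_Cexp (F : C -> C) (z d : C) :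
  has_deriv F z d -> has_deriv (fun w => Cexp (F w)) z (d * Cexp (F z))%C.
Proof.
  intros HF v. destruct (HF v) as [F1 F2].
  assert (Hz : (z + RtoC 0 * v)%C = z) by ring.
  unfold Cexp.
  assert (E1 : ex_derive (fun t : R => Re (F (z + RtoC t * v)%C)) 0) by (eexists; apply F1).
  assert (E2 : ex_derive (fun t : R => Im (F (z + RtoC t * v)%C)) 0) by (eexists; apply F2).
  assert (D1 := is_derive_unique _ _ _ F1). assert (D2 := is_derive_unique _ _ _ F2).
  set (f1 := fun t : R => Re (F (z + RtoC t * v)%C)) in *.
  set (f2 := fun t : R => Im (F (z + RtoC t * v)%C)) in *.
  assert (Hf1 : f1 0 = Re (F z)) by (unfold f1; now rewrite Hz).
  assert (Hf2 : f2 0 = Im (F z)) by (unfold f2; now rewrite Hz).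
  split.
  - apply (is_derive_ext (fun t => exp (f1 t) * cos (f2 t))); [intros t; reflexivity|].
    auto_derive; [tauto|].
    change (fun x => f1 x) with f1. change (fun x => f2 x) with f2.
    rewrite D1, D2, Hf1, Hf2. simpl. ring.
  - apply (is_derive_ext (fun t => exp (f1 t) * sin (f2 t))); [intros t; reflexivity|].
    auto_derive; [tauto|].
    change (fun x => f1 x) with f1. change (fun x => f2 x) with f2.
    rewrite D1, D2, Hf1, Hf2. simpl. ring.
Qed.

(** Along the segment from [z0] to [z] both components have derivative 0 as functions of a real
    parameter. This is the uniqueness principle by which series sums are later identified with
    explicit functions. *)
Lemma has_deriv_zero_const (F : C -> C) (z0 : C) (r : R) :
  (forall z, Cmod (z - z0)%C < r -> has_deriv F z 0) ->
  forall z, Cmod (z - z0)%C < r -> F z = F z0.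
Proof.
  intros HF z Hz. set (v := (z - z0)%C).
  assert (Hd : forall t : R, 0 <= t <= 1 ->
     is_derive (fun s : R => Re (F (z0 + RtoC s * v)%C)) t 0 /\
     is_derive (fun s : R => Im (F (z0 + RtoC s * v)%C)) t 0).
  { intros t Ht. destruct (HF (z0 + RtoC t * v)%C) with (v := v) as [H1 H2].
    - replace (z0 + RtoC t * v - z0)%C with (RtoC t * v)%C by ring.
      rewrite Cmod_mult, Cmod_R, Rabs_pos_eq by lra.
      pose proof (Cmod_ge_0 v). fold v in Hz. nra.
    - rewrite Cmult_0_r in H1, H2.
      assert (Hsub : is_derive (fun s : R => s - t) t 1) by (auto_derive; auto; ring).
      (* Directional derivatives live at parameter 0; composing with [s - t] moves them to [t]. *)
      replace 0 with (t - t) in H1, H2 by ring.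
      assert (K1 := is_derive_comp _ (fun s => s - t) t _ _ H1 Hsub).
      assert (K2 := is_derive_comp _ (fun s => s - t) t _ _ H2 Hsub).
      split.
      + evar (l : R). replace 0 with l.
        * eapply is_derive_ext; [|exact K1]. intros s. simpl. do 2 f_equal.
          rewrite RtoC_minus. ring.
        * unfold l. change (1 * (t - t) = 0). ring.
      + evar (l : R). replace 0 with l.
        * eapply is_derive_ext; [|exact K2]. intros s. simpl. do 2 f_equal.
          rewrite RtoC_minus. ring.
        * unfold l. change (1 * 0 = 0). ring. }
  assert (E1 := eq_is_derive _ 0 1 (fun t Ht => proj1 (Hd t Ht)) Rlt_0_1).
  assert (E2 := eq_is_derive _ 0 1 (fun t Ht => proj2 (Hd t Ht)) Rlt_0_1).
  simpl in E1, E2.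
  replace (z0 + RtoC 0 * v)%C with z0 in E1, E2 by ring.
  replace (z0 + RtoC 1 * v)%C with z in E1, E2 by (unfold v; ring).
  symmetry. apply injective_projections; assumption.
Qed.

Lemma is_Cpseries_has_deriv (a : nat -> C) (r : R) (F : C -> C) (z : C) :
  (forall h, Cmod h < r -> is_Cpseries a h (F h)) -> Cmod z < r ->
  exists d, is_Cpseries (Cderiv_coeff a) z d /\ has_deriv F z d.
Proof.
  intros HF Hz.
  destruct (converges_on_disk_derive a r) with (h := z) as [d Hd]; auto.
  { intros h Hh. eexists. apply HF, Hh. }
  exists d. split; [exact Hd|].
  destruct (is_Cpseries_taylor_bound a r F z d HF Hz Hd) as (K & delta & Hdelta & H).
  now apply has_deriv_quadratic with K delta.
Qed.

(** * Analytic functions *)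

Lemma analytic_at_shift (f : C -> C) (z0 : C) (r : R) (a : nat -> C) :
  (forall z, Cmod (z - z0)%C < r -> is_Cpseries a (z - z0)%C (f z)) ->
  forall h, Cmod h < r -> is_Cpseries a h (f (z0 + h)%C).
Proof.
  intros Ha h Hh. replace h with (z0 + h - z0)%C at 1 by ring. apply Ha.
  now replace (z0 + h - z0)%C with h by ring.
Qed.

Lemma analytic_at_derive (f : C -> C) (z0 : C) :
  analytic_at f z0 -> analytic_at (C_derive f) z0.
Proof.
  intros (r & a & Ha). exists r, (Cderiv_coeff a). intros z Hz.
  destruct (is_Cpseries_has_deriv a r (fun h => f (z0 + h)%C) (z - z0)%C) as (d & Hs & Hd); auto.
  { exact (analytic_at_shift f z0 r a Ha). }
  apply has_deriv_shift in Hd.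
  apply has_deriv_ext_loc with (G := f) (delta := 1) in Hd; [|lra|].
  - now rewrite (has_deriv_C_derive _ _ _ Hd).
  - intros h _. f_equal. ring.
Qed.

Lemma analytic_at_plus (f g : C -> C) (z0 : C) :
  analytic_at f z0 -> analytic_at g z0 -> analytic_at (fun z => (f z + g z)%C) z0.
Proof.
  intros (r & a & Ha) (s & b & Hb).
  exists (mkposreal _ (Rmin_pos _ _ (cond_pos r) (cond_pos s))).
  exists (PS_plus (K := C_AbsRing) (V := C_NormedModule) a b). simpl. intros z Hz.
  apply (is_pseries_plus (K := C_AbsRing) (V := C_NormedModule)).
  - apply Ha. apply Rlt_le_trans with (1 := Hz), Rmin_l.
  - apply Hb. apply Rlt_le_trans with (1 := Hz), Rmin_r.
Qed.

Lemma analytic_at_scal (k : C) (f : C -> C) (z0 : C) :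
  analytic_at f z0 -> analytic_at (fun z => (k * f z)%C) z0.
Proof.
  intros (r & a & Ha).
  exists r, (PS_scal (K := C_AbsRing) (V := C_NormedModule) k a). intros z Hz.
  apply (is_pseries_scal (K := C_AbsRing) (V := C_NormedModule)); [apply Cmult_comm|].
  now apply Ha.
Qed.

(** Writing [z = z0 + (z - z0)] turns the product into a scaling plus an index shift. It covers the
    term [z f''], so no Cauchy product has to be formed. *)
Lemma analytic_at_mul_id (f : C -> C) (z0 : C) :
  analytic_at f z0 -> analytic_at (fun z => (z * f z)%C) z0.
Proof.
  intros (r & a & Ha).
  exists r, (PS_plus (K := C_AbsRing) (V := C_NormedModule)
    (PS_scal (K := C_AbsRing) (V := C_NormedModule) z0 a)
    (PS_incr_1 (K := C_AbsRing) (V := C_NormedModule) a)). intros z Hz.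
  replace (z * f z)%C with (z0 * f z + (z - z0) * f z)%C by ring.
  apply (is_pseries_plus (K := C_AbsRing) (V := C_NormedModule)).
  - apply (is_pseries_scal (K := C_AbsRing) (V := C_NormedModule)); [apply Cmult_comm|].
    now apply Ha.
  - apply (is_pseries_incr_1 (K := C_AbsRing) (V := C_NormedModule)). now apply Ha.
Qed.

(** Balls of the product structure on [C] are squares; a square of half-side [delta / 2] fits inside
    the disk of radius [delta]. *)
Lemma locally_C_Cmod (z : C) (P : C -> Prop) (delta : R) :
  0 < delta -> (forall w, Cmod (w - z)%C < delta -> P w) -> locally z P.
Proof.
  intros Hd HP.
  exists (mkposreal (delta / 2) ltac:(lra)). intros w [H1 H2]. apply HP.
  change (Rabs (fst w - fst z) < delta / 2) in H1.
  change (Rabs (snd w - snd z) < delta / 2) in H2.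
  replace (w - z)%C with (RtoC (fst w - fst z) + Ci * RtoC (snd w - snd z))%C.
  - eapply Rle_lt_trans; [apply Cmod_triangle|].
    rewrite Cmod_mult, Cmod_Ci, !Cmod_R. lra.
  - apply injective_projections; simpl; ring.
Qed.

Lemma ball_C_Cmod (z w : C) (delta : R) : Cmod (w - z)%C < delta -> ball z delta w.
Proof. exact (C_NormedModule_mixin_compat1 z w delta). Qed.

(** Supplies a nearby point in a prescribed direction: one where a modulus grows in the local
    maximum principle, one farther from 0 in Schwarz' lemma. *)
Lemma locally_C_ray (z u : C) (P : C -> Prop) :
  locally z P -> exists rho, 0 < rho /\ P (z + RtoC rho * u)%C.
Proof.
  intros [delta HP].
  assert (Hu := Cmod_ge_0 u). assert (Hd := cond_pos delta).
  assert (Hrho : 0 < delta / (2 * (Cmod u + 1))) by (apply Rdiv_lt_0_compat; lra).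
  exists (delta / (2 * (Cmod u + 1))). split; [exact Hrho|].
  apply HP.
  apply ball_C_Cmod.
  replace (z + RtoC (delta / (2 * (Cmod u + 1))) * u - z)%C
    with (RtoC (delta / (2 * (Cmod u + 1))) * u)%C by ring.
  rewrite Cmod_mult, Cmod_R, Rabs_pos_eq by lra.
  replace (delta / (2 * (Cmod u + 1)) * Cmod u) with (delta * Cmod u / (2 * (Cmod u + 1)))
    by (field; lra).
  apply Rlt_div_l; nra.
Qed.

(** Continuity is kept by components so that real continuity of sums, products and square roots
    applies directly. *)
Definition Ccontinuous (F : C -> C) (z : C) : Prop :=
  continuous (fun w : C => Re (F w)) z /\ continuous (fun w : C => Im (F w)) z.

Lemma is_Cpseries_continuous (a : nat -> C) (r : R) (F : C -> C) (z : C) :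
  (forall h, Cmod h < r -> is_Cpseries a h (F h)) -> Cmod z < r -> Ccontinuous F z.
Proof.
  intros HF Hz.
  destruct (converges_on_disk_derive a r) with (h := z) as [d Hd]; auto.
  { intros h Hh. eexists. apply HF, Hh. }
  destruct (is_Cpseries_taylor_bound a r F z d HF Hz Hd) as (K & delta & Hdelta & H).
  (* At distance less than 1 the quadratic error is at most [|K|] times the distance, so [L] is a
     Lipschitz constant at [z]; the 1 makes it positive. *)
  set (L := Rabs K + Cmod d + 1).
  assert (HL : 0 < L) by (unfold L; pose proof (Rabs_pos K); pose proof (Cmod_ge_0 d); lra).
  assert (Hlip : forall eps : posreal, locally z (fun w : C => Cmod (F w - F z)%C < eps)).
  { intros eps. assert (Heps := cond_pos eps).
    apply locally_C_Cmod with (Rmin (Rmin delta 1) (eps / L)).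
    { repeat apply Rmin_pos; try lra. apply Rdiv_lt_0_compat; lra. }
    intros w Hw.
    assert (H1 := Rlt_le_trans _ _ _ Hw (Rmin_l _ _)).
    assert (H2 := Rlt_le_trans _ _ _ Hw (Rmin_r _ _)).
    assert (H3 := Rlt_le_trans _ _ _ H1 (Rmin_r _ _)).
    assert (H4 := Rlt_le_trans _ _ _ H1 (Rmin_l _ _)).
    apply Rlt_div_r in H2; [|lra].
    specialize (H _ H4). replace (z + (w - z))%C with w in H by ring.
    replace (F w - F z)%C with ((F w - F z - (w - z) * d) + (w - z) * d)%C by ring.
    eapply Rle_lt_trans; [apply Cmod_triangle|]. rewrite Cmod_mult.
    assert (H0 := Cmod_ge_0 (w - z)%C).
    assert (Cmod (F w - F z - (w - z) * d)%C <= Rabs K * Cmod (w - z)%C).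
    { eapply Rle_trans; [exact H|]. pose proof (Rle_abs K). pose proof (Rabs_pos K).
      apply Rle_trans with (Rabs K * Cmod (w - z)%C ^ 2); [apply Rmult_le_compat_r|apply Rmult_le_compat_l]; nra. }
    unfold L in H2. nra. }
  split; apply filterlim_locally; intros eps;
    eapply filter_imp with (2 := Hlip eps); intros w Hw; (eapply Rle_lt_trans; [|exact Hw]).
  - exact (re_le_Cmod (F w - F z)%C).
  - exact (im_le_Cmod (F w - F z)%C).
Qed.

Lemma Ccontinuous_shift (F : C -> C) (z0 z : C) :
  Ccontinuous F (z - z0)%C -> Ccontinuous (fun w => F (w - z0)%C) z.
Proof.
  assert (Hs : filterlim (fun w : C => (w - z0)%C) (locally z) (locally (z - z0)%C)).
  { apply filterlim_locally. intros eps. apply locally_C_Cmod with eps; [apply cond_pos|].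
    intros w Hw. apply ball_C_Cmod.
    now replace (w - z0 - (z - z0))%C with (w - z)%C by ring. }
  intros [H1 H2]. split.
  - exact (filterlim_comp _ _ _ _ _ _ _ _ Hs H1).
  - exact (filterlim_comp _ _ _ _ _ _ _ _ Hs H2).
Qed.

Lemma analytic_at_continuous (f : C -> C) (z0 : C) :
  analytic_at f z0 -> Ccontinuous f z0.
Proof.
  intros (r & a & Ha).
  assert (H : Ccontinuous (fun h => f (z0 + h)%C) (z0 - z0)%C).
  { replace (z0 - z0)%C with (RtoC 0) by ring.
    apply is_Cpseries_continuous with a r; [|rewrite Cmod_0; apply cond_pos].
    exact (analytic_at_shift f z0 r a Ha). }
  apply Ccontinuous_shift in H. destruct H as [H1 H2].
  assert (Hw : forall w : C, (z0 + (w - z0))%C = w) by (intros w; ring).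
  split.
  - apply (continuous_ext (fun w : C => Re (f (z0 + (w - z0))%C)));
      [intros w; now rewrite Hw|exact H1].
  - apply (continuous_ext (fun w : C => Im (f (z0 + (w - z0))%C)));
      [intros w; now rewrite Hw|exact H2].
Qed.

Lemma Ccontinuous_Cmod (F : C -> C) (z : C) :
  Ccontinuous F z -> continuous (fun w : C => Cmod (F w)) z.
Proof.
  intros [H1 H2].
  apply (continuous_ext (fun w : C => sqrt (plus (mult (Re (F w)) (Re (F w))) (mult (Im (F w)) (Im (F w)))))).
  { intros w. unfold Cmod, Re, Im, plus, mult. simpl. f_equal. ring. }
  apply continuous_comp; [|apply continuous_sqrt].
  apply (continuous_plus (V := R_NormedModule)); apply (continuous_mult (K := R_AbsRing)); assumption.
Qed.

Lemma continuous_lt_locally (f g : C -> R) (z : C) :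
  continuous f z -> continuous g z -> f z < g z -> locally z (fun w => f w < g w).
Proof.
  intros Hf Hg Hlt.
  assert (He : 0 < (g z - f z) / 2) by lra.
  assert (H1 := proj1 (filterlim_locally _ _) Hf (mkposreal _ He)).
  assert (H2 := proj1 (filterlim_locally _ _) Hg (mkposreal _ He)).
  eapply filter_imp with (2 := filter_and _ _ H1 H2).
  intros w [K1 K2].
  change (Rabs (f w - f z) < (g z - f z) / 2) in K1.
  change (Rabs (g w - g z) < (g z - f z) / 2) in K2.
  apply Rabs_def2 in K1. apply Rabs_def2 in K2. lra.
Qed.

(** * Maxima on compact subsets of the plane *)

Lemma list_argmax (T : Type) (n : T -> R) (l : list T) :
  l <> nil -> exists t, In t l /\ forall t', In t' l -> n t' <= n t.
Proof.
  induction l as [|x l IH]; [congruence|]. intros _.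
  destruct l as [|y l].
  - exists x. split; [now left|]. intros t' [<-|[]]. apply Rle_refl.
  - destruct IH as (t & Ht & Hmax); [discriminate|].
    destruct (Rle_dec (n x) (n t)) as [Hx|Hx].
    + exists t. split; [now right|]. intros t' [<-|Ht']; auto.
    + exists x. split; [now left|]. intros t' [<-|Ht']; [apply Rle_refl|].
      apply Hmax in Ht'. lra.
Qed.

(** If no maximum were attained, every point of [P] would have a neighborhood on which [n] stays
    below the value at some other point of [P]. By compactness finitely many such values bound [n]
    on [P], yet the largest of them is itself a value of [n] on [P]. Semicontinuity is asked only at
    points of [P], as the function maximized later is continuous only inside the unit disk. *)
Lemma compact_max (P : C -> Prop) (n : C -> R) (r : R) :
  (exists z, P z) -> (forall z, P z -> Cmod z <= r) ->
  (forall z, ~ P z -> locally z (fun w => ~ P w)) ->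
  (forall z y, P z -> n z < y -> locally z (fun w => P w -> n w < y)) ->
  exists z, P z /\ forall w, P w -> n w <= n z.
Proof.
  intros [w0 Hw0] Hb Hcl Husc.
  apply NNPP. intros Hno.
  assert (Hs : forall t : C, exists sd : C * posreal,
    P (fst sd) /\ forall w : C, ball t (snd sd) w -> P w -> n w < n (fst sd)).
  { intros t. destruct (classic (P t)) as [Ht|Ht].
    - assert (Hex : exists s, P s /\ n t < n s).
      { apply NNPP. intros Hn. apply Hno. exists t. split; [exact Ht|].
        intros w Hw. apply Rnot_lt_le. intros Hlt. apply Hn. now exists w. }
      destruct Hex as (s & Hs & Hlt).
      destruct (Husc t (n s) Ht Hlt) as [d Hd]. exists (s, d). split; [exact Hs|exact Hd].
    - destruct (Hcl t Ht) as [d Hd]. exists (w0, d). split; [exact Hw0|].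
      intros w Hw Pw. now elim (Hd w Hw). }
  set (sd := fun t => proj1_sig (constructive_indefinite_description _ (Hs t))).
  assert (Hsd : forall t, P (fst (sd t)) /\
    forall w : C, ball t (snd (sd t)) w -> P w -> n w < n (fst (sd t))).
  { intros t. exact (proj2_sig (constructive_indefinite_description _ (Hs t))). }
  clearbody sd.
  set (toC := fun t : Compactness.Tn 2 R => (fst t, fst (snd t)) : C).
  set (lo := (- r, (- r, tt)) : Compactness.Tn 2 R).
  set (hi := (r, (r, tt)) : Compactness.Tn 2 R).
  (* The finite subcover is provided under a double negation, which is harmless as the goal is
     [False]. *)
  apply (compactness_list 2 lo hi (fun t => snd (sd (toC t)))).
  intros [l Hl].
  assert (Hcover : forall w, P w -> exists t, In t l /\ n w < n (fst (sd (toC t)))).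
  { intros w Hw.
    assert (Hwr := Hb w Hw).
    assert (H1 := Rle_trans _ _ _ (re_le_Cmod w) Hwr). apply Rabs_le_between in H1.
    assert (H2 := Rle_trans _ _ _ (im_le_Cmod w) Hwr). apply Rabs_le_between in H2.
    destruct (Hl (fst w, (snd w, tt))) as (t & Hin & _ & Hclose).
    { simpl. unfold Re, Im in H1, H2. tauto. }
    exists t. split; [exact Hin|].
    apply (proj2 (Hsd (toC t))); [|exact Hw].
    destruct t as (t1 & t2 & []). simpl in Hclose. split; apply Hclose. }
  destruct (list_argmax _ (fun t => n (fst (sd (toC t)))) l) as (t & Ht & Hmax).
  { intros ->. destruct (Hcover w0 Hw0) as (t & [] & _). }
  destruct (Hcover _ (proj1 (Hsd (toC t)))) as (t' & Ht' & Hlt).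
  apply Hmax in Ht'. lra.
Qed.

(** * The local maximum principle *)

Lemma is_series_R_zero : is_series (fun _ : nat => 0) 0.
Proof.
  change (is_lim_seq (sum_n (fun _ : nat => 0)) 0).
  apply is_lim_seq_ext with (fun _ => 0); [|apply is_lim_seq_const].
  intros n. induction n as [|n IH]; [now rewrite sum_O|].
  rewrite sum_Sn, <- IH. symmetry. apply Rplus_0_l.
Qed.

Lemma is_Cseries_unique (a : nat -> C) (l l' : C) :
  is_Cseries a l -> is_Cseries a l' -> l = l'.
Proof.
  intros H H'.
  assert (H0 := is_series_Cmod_le _ _ _ _ (is_Cseries_minus _ _ _ _ H H') is_series_R_zero).
  replace l with (l - l' + l')%C by ring.
  rewrite (Cmod_eq_0 (l - l')%C); [ring|].
  apply Rle_antisym; [|apply Cmod_ge_0]. apply H0.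
  intros n. replace (a n - a n)%C with (RtoC 0) by ring. rewrite Cmod_0. apply Rle_refl.
Qed.

Lemma is_Cpseries_0 (a : nat -> C) : is_Cpseries a (RtoC 0) (a 0%nat).
Proof. exact (is_pseries_0 (K := C_AbsRing) (V := C_NormedModule) a). Qed.

Lemma is_Cpseries_factor (k : nat) (a : nat -> C) (r : R) (F : C -> C) :
  0 < r ->
  (forall h, Cmod h < r -> is_Cpseries a h (F h)) -> (forall i, (i < k)%nat -> a i = RtoC 0) ->
  exists E : C -> C, forall h, Cmod h < r ->
    is_Cpseries (fun n => a (k + n)%nat) h (E h) /\ F h = (h ^ k * E h)%C.
Proof.
  intros Hr. revert a F. induction k as [|k IH]; intros a F HF Ha.
  - exists F. intros h Hh. split; [now apply HF|]. simpl. ring.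
  - assert (Ha0 : a 0%nat = RtoC 0) by (apply Ha; lia).
    (* At [h = 0] the quotient takes the value [a 1], the constant term of the shifted series. *)
    set (F' := fun h : C => if Ceq_dec h (RtoC 0) then a 1%nat else (/ h * F h)%C).
    destruct (IH (PS_decr_1 (K := C_AbsRing) (V := C_NormedModule) a) F') as [E HE].
    + intros h Hh. unfold F'. destruct (Ceq_dec h (RtoC 0)) as [->|H0].
      * apply is_Cpseries_0.
      * replace (/ h * F h)%C with (/ h * (F h + - a 0%nat))%C by (rewrite Ha0; ring).
        apply (is_pseries_decr_1 (K := C_AbsRing) (V := C_NormedModule)).
        -- apply Cinv_l, H0.
        -- now apply HF.
    + intros i Hi. apply Ha. lia.
    + exists E. intros h Hh. destruct (HE h Hh) as [H1 H2]. split; [exact H1|].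
      rewrite Cpow_S, <- Cmult_assoc, <- H2. unfold F'.
      destruct (Ceq_dec h (RtoC 0)) as [->|H0].
      * rewrite Cmult_0_l. transitivity (a 0%nat); [|exact Ha0].
        apply (is_Cseries_unique _ _ _ (HF _ Hh)). apply is_Cpseries_0.
      * now rewrite Cmult_assoc, Cinv_r, Cmult_1_l.
Qed.

(** Either all Taylor coefficients vanish, or the least index [k] of a nonzero one is the order of
    the zero, and that coefficient is [E z0]. *)
Lemma analytic_at_factor (f : C -> C) (z0 : C) :
  analytic_at f z0 ->
  locally z0 (fun w => f w = RtoC 0) \/
  exists k E, Ccontinuous E z0 /\ E z0 <> RtoC 0 /\
    locally z0 (fun w => f w = ((w - z0) ^ k * E w)%C).
Proof.
  intros (r & a & Ha). assert (Hr := cond_pos r).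
  assert (HF := analytic_at_shift f z0 r a Ha).
  destruct (classic (forall n, a n = RtoC 0)) as [H0|H0].
  - left. apply locally_C_Cmod with r; [exact Hr|]. intros w Hw.
    apply (is_Cseries_unique _ _ _ (Ha w Hw)).
    apply is_series_ext with (fun _ => RtoC 0).
    { intros n. rewrite H0. symmetry. exact (Cmult_0_r _). }
    assert (H := is_Cseries_minus _ _ _ _ (Ha w Hw) (Ha w Hw)).
    replace (f w - f w)%C with (RtoC 0) in H by ring.
    eapply is_series_ext; [|exact H]. intros n.
    match goal with |- ?x = ?y => change (@eq C x y) end. simpl. unfold Cminus. apply Cplus_opp_r.
  - right.
    assert (Hk : exists k, a k <> RtoC 0 /\ forall i, (i < k)%nat -> a i = RtoC 0).
    { apply not_all_ex_not in H0. destruct H0 as [n Hn].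
      induction n as [n IH] using (well_founded_induction Wf_nat.lt_wf).
      destruct (classic (exists i, (i < n)%nat /\ a i <> RtoC 0)) as [(i & Hi & Hai)|Hno].
      - now apply IH with i.
      - exists n. split; [exact Hn|]. intros i Hi. apply NNPP. intros Hai. apply Hno. now exists i. }
    destruct Hk as (k & Hk & Hlt).
    destruct (is_Cpseries_factor k a r _ Hr HF Hlt) as [E HE].
    exists k, (fun w => E (w - z0)%C). repeat split.
    1, 2: apply Ccontinuous_shift; replace (z0 - z0)%C with (RtoC 0) by ring;
          apply is_Cpseries_continuous with (fun n => a (k + n)%nat) r;
          [intros h Hh; now apply HE|now rewrite Cmod_0].
    + replace (z0 - z0)%C with (RtoC 0) by ring.
      destruct (HE (RtoC 0)) as [H1 _]; [now rewrite Cmod_0|].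
      rewrite (is_Cseries_unique _ _ _ H1 (is_Cpseries_0 _)).
      now rewrite PeanoNat.Nat.add_0_r.
    + apply locally_C_Cmod with r; [exact Hr|]. intros w Hw.
      destruct (HE _ Hw) as [_ H2]. rewrite <- H2. f_equal. ring.
Qed.

Lemma cos_sin_pow (t : R) (k : nat) :
  ((cos t, sin t) ^ k)%C = (cos (INR k * t), sin (INR k * t)).
Proof.
  induction k as [|k IH].
  - simpl. rewrite Rmult_0_l, cos_0, sin_0. reflexivity.
  - rewrite Cpow_S, IH, S_INR, Rmult_plus_distr_r, Rmult_1_l, cos_plus, sin_plus.
    apply injective_projections; simpl; ring.
Qed.

(** One of the four numbers 1, -1, i, -i rotates [w] into the open right half-plane, and each has an
    explicit k-th root. *)
Lemma exists_pow_Re_pos (k : nat) (w : C) :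
  (0 < k)%nat -> w <> RtoC 0 -> exists u : C, 0 < Re (u ^ k * w)%C.
Proof.
  intros Hk Hw.
  assert (HkR : 0 < INR k) by (apply lt_0_INR, Hk).
  assert (Hpow : forall t, ((cos (t / INR k), sin (t / INR k)) ^ k)%C = (cos t, sin t)).
  { intros t. rewrite cos_sin_pow. now replace (INR k * (t / INR k)) with t by (field; lra). }
  destruct (Rtotal_order (Re w) 0) as [H|[H|H]].
  - exists (cos (PI / INR k), sin (PI / INR k)). rewrite Hpow, cos_PI, sin_PI.
    unfold Re in *. simpl. lra.
  - destruct (Rtotal_order (Im w) 0) as [H'|[H'|H']].
    + exists (cos (PI / 2 / INR k), sin (PI / 2 / INR k)). rewrite Hpow, cos_PI2, sin_PI2.
      unfold Re, Im in *. simpl. lra.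
    + elim Hw. apply injective_projections; assumption.
    + exists (cos (- (PI / 2) / INR k), sin (- (PI / 2) / INR k)).
      rewrite Hpow, cos_neg, sin_neg, cos_PI2, sin_PI2.
      unfold Re, Im in *. simpl. lra.
  - exists (RtoC 1). rewrite Cpow_1_l, Cmult_1_l. exact H.
Qed.

Lemma Cmod2_plus (x y : C) :
  Cmod (x + y)%C ^ 2 = Cmod x ^ 2 + Cmod y ^ 2 + 2 * Re (x * Cconj y)%C.
Proof.
  rewrite !Cmod2_alt. destruct x, y. unfold Re, Im. simpl. ring.
Qed.

Lemma continuous_Re_mult_conj (X Y : C -> C) (z : C) :
  Ccontinuous X z -> Ccontinuous Y z -> continuous (fun w : C => Re (X w * Cconj (Y w))%C) z.
Proof.
  intros [X1 X2] [Y1 Y2].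
  apply (continuous_ext (fun w : C => plus (mult (Re (X w)) (Re (Y w))) (mult (Im (X w)) (Im (Y w))))).
  { intros w. unfold plus, mult, Re, Im. simpl. ring. }
  apply (continuous_plus (V := R_NormedModule)); apply (continuous_mult (K := R_AbsRing)); assumption.
Qed.

(** Otherwise [A - q B] behaves like [(w - z0)^k E(z0)] with [E(z0)] nonzero. Moving from [z0] in a
    direction [u] for which [u^k E(z0)] has positive inner product with [A z0 = q B z0] makes [|A|]
    exceed [|q B|]. The positive inner product is what [A z0 <> 0] allows. *)
Lemma analytic_at_local_max (A B : C -> C) (z0 q : C) :
  analytic_at A z0 -> analytic_at B z0 -> A z0 = (q * B z0)%C -> A z0 <> RtoC 0 ->
  locally z0 (fun w => Cmod (A w) <= Cmod q * Cmod (B w)) ->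
  locally z0 (fun w => A w = (q * B w)%C).
Proof.
  intros HA HB Hq HA0 Hmax.
  assert (HqB := analytic_at_scal q B z0 HB).
  assert (HD := analytic_at_plus _ _ z0 HA (analytic_at_scal (RtoC (-1)) _ z0 HqB)).
  apply analytic_at_factor in HD. destruct HD as [HD|(k & E & HE & HE0 & HD)].
  - eapply filter_imp with (2 := HD). intros w Hw.
    replace (A w) with ((A w + RtoC (-1) * (q * B w)) + q * B w)%C by ring.
    rewrite Hw. ring.
  - exfalso.
    (* The order is positive because [A - q B] vanishes at [z0]. *)
    assert (Hk : (0 < k)%nat).
    { destruct k as [|k]; [|lia]. exfalso. apply HE0.
      apply locally_singleton in HD. rewrite Hq in HD.
      replace (E z0) with ((z0 - z0) ^ 0 * E z0)%C by (simpl; ring).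
      rewrite <- HD. ring. }
    destruct (exists_pow_Re_pos k (E z0 * Cconj (A z0))%C Hk) as [u Hu].
    { apply Cmult_neq_0; [exact HE0|]. intros H.
      apply HA0. rewrite <- (Cconj_conj (A z0)), H. apply injective_projections; simpl; ring. }
    assert (HX : Ccontinuous (fun w => (u ^ k * E w)%C) z0).
    { destruct HE as [E1 E2]. split.
      - apply (continuous_ext (fun w : C => minus (scal (Re (u ^ k)%C) (Re (E w))) (scal (Im (u ^ k)%C) (Im (E w))))).
        { intros w. reflexivity. }
        apply (continuous_minus (V := R_NormedModule)); apply (continuous_scal_r (V := R_NormedModule)); assumption.
      - apply (continuous_ext (fun w : C => plus (scal (Re (u ^ k)%C) (Im (E w))) (scal (Im (u ^ k)%C) (Re (E w))))).
        { intros w. reflexivity. }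
        apply (continuous_plus (V := R_NormedModule)); apply (continuous_scal_r (V := R_NormedModule)); assumption. }
    assert (HY := analytic_at_continuous _ _ HqB).
    assert (Hpos := continuous_lt_locally _ _ _ (continuous_const 0 z0) (continuous_Re_mult_conj _ _ _ HX HY)).
    cbv beta in Hpos. rewrite <- Hq in Hpos. rewrite <- Cmult_assoc in Hpos. specialize (Hpos Hu).
    destruct (locally_C_ray z0 u _ (filter_and _ _ Hpos (filter_and _ _ HD Hmax)))
      as (rho & Hrho & H1 & H2 & H3).
    set (w := (z0 + RtoC rho * u)%C) in *.
    replace (w - z0)%C with (RtoC rho * u)%C in H2 by (unfold w; ring).
    rewrite Cpow_mult_l, <- RtoC_pow in H2.
    assert (HAw : A w = (q * B w + RtoC (rho ^ k) * (u ^ k * E w))%C).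
    { replace (A w) with ((A w + RtoC (-1) * (q * B w)) + q * B w)%C by ring. rewrite H2. ring. }
    rewrite <- Cmod_mult in H3.
    assert (Hsq : Cmod (A w) ^ 2 <= Cmod (q * B w)%C ^ 2).
    { apply pow_incr. split; [apply Cmod_ge_0|exact H3]. }
    rewrite HAw, Cplus_comm, Cmod2_plus in Hsq.
    rewrite <- Cmult_assoc, re_scal_l in Hsq.
    assert (Hrk : 0 < rho ^ k) by (apply pow_lt, Hrho).
    pose proof (pow2_ge_0 (Cmod (RtoC (rho ^ k) * (u ^ k * E w))%C)).
    nra.
Qed.

(** * Schwarz' lemma and the characterization *)

Lemma continuous_Cmod (z : C) : continuous (fun w : C => Cmod w) z.
Proof.
  apply (Ccontinuous_Cmod (fun w => w)). split; [apply continuous_fst|apply continuous_snd].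
Qed.

(* Schwarz' lemma for [z * A z / B z], stated without forming the quotient.  If [|A / B|] were
   [> 1] somewhere, it would have on some closed disk of radius [r < 1] a maximum exceeding its
   boundary values; at a maximum point of largest modulus [A / B] is locally constant, so there
   is a maximum point of still larger modulus. *)
Lemma schwarz_quotient (A B : C -> C) :
  analytic_on unit_disk A -> analytic_on unit_disk B ->
  (forall z, unit_disk z -> B z <> RtoC 0) ->
  (forall z, unit_disk z -> Cmod z * Cmod (A z) <= Cmod (B z)) ->
  forall z, unit_disk z -> Cmod (A z) <= Cmod (B z).
Proof.
  intros HA HB HB0 HAB z0 Hz0. apply Rnot_lt_le. intros Hlt.
  assert (HBpos : forall z, unit_disk z -> 0 < Cmod (B z)) by (intros z Hz; now apply Cmod_gt_0, HB0).
  set (m := fun z => Cmod (A z) * / Cmod (B z)).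
  assert (HmA : forall z, unit_disk z -> Cmod (A z) = m z * Cmod (B z)).
  { intros z Hz. unfold m. specialize (HBpos z Hz). field. lra. }
  assert (Hmcont : forall z, unit_disk z -> continuous m z).
  { intros z Hz. apply (continuous_mult (K := R_AbsRing)).
    - apply Ccontinuous_Cmod, analytic_at_continuous, HA, Hz.
    - apply (continuous_comp (fun w : C => Cmod (B w)) Rinv).
      + apply Ccontinuous_Cmod, analytic_at_continuous, HB, Hz.
      + apply continuous_Rinv. specialize (HBpos z Hz). lra. }
  assert (Hm0 : 1 < m z0).
  { assert (H1 := HBpos z0 Hz0). rewrite (HmA z0 Hz0) in Hlt. nra. }
  (* The disk must contain [z0], and [r > 1 / m z0] forces the values on its boundary, at most
     [1 / r], below [m z0]. The midpoint of [1 / m z0] and 1 achieves this with [r < 1]. *)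
  set (r := Rmax (Cmod z0) ((1 + / m z0) / 2)).
  assert (Him : 0 < / m z0 < 1).
  { split; [apply Rinv_0_lt_compat; lra|]. rewrite <- Rinv_1. apply Rinv_lt_contravar; lra. }
  assert (Hr : Cmod z0 <= r < 1 /\ / m z0 < r).
  { unfold unit_disk in Hz0. unfold r. assert (K1 := Rmax_l (Cmod z0) ((1 + / m z0) / 2)).
    assert (K2 := Rmax_r (Cmod z0) ((1 + / m z0) / 2)).
    repeat split; [exact K1|apply Rmax_lub_lt; lra|lra]. }
  destruct Hr as [[Hr0 Hr1] Hrm].
  assert (Hdisk : forall z, Cmod z <= r -> unit_disk z) by (unfold unit_disk; intros; lra).
  assert (Hout : forall z, ~ Cmod z <= r -> locally z (fun w => ~ Cmod w <= r)).
  { intros z Hz. assert (H := continuous_lt_locally _ _ z (continuous_const r z) (continuous_Cmod z)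
      (Rnot_le_lt _ _ Hz)).
    eapply filter_imp with (2 := H). intros w Hw. cbv beta in Hw. lra. }
  destruct (compact_max (fun z => Cmod z <= r) m r) as (z1 & Hz1 & Hmax); auto.
  { now exists z0. }
  { intros z y Hz Hy.
    assert (H := continuous_lt_locally _ _ z (Hmcont z (Hdisk z Hz)) (continuous_const y z) Hy).
    eapply filter_imp with (2 := H). intros w Hw _. exact Hw. }
  destruct (compact_max (fun z => Cmod z <= r /\ m z = m z1) Cmod r) as (z2 & [Hz2 Hm2] & Hmax2).
  { exists z1. auto. }
  { intros z Hz. apply Hz. }
  { intros z Hz. destruct (Rle_dec (Cmod z) r) as [Hzr|Hzr].
    - assert (Hzm : m z < m z1).
      { destruct (Hmax z Hzr) as [H|H]; [exact H|]. now elim Hz. }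
      assert (H := continuous_lt_locally _ _ z (Hmcont z (Hdisk z Hzr)) (continuous_const (m z1) z) Hzm).
      eapply filter_imp with (2 := H). intros w Hw [_ Hw']. cbv beta in Hw. lra.
    - eapply filter_imp with (2 := Hout z Hzr). intros w Hw [Hw' _]. now apply Hw. }
  { intros z y Hz Hy.
    assert (H := continuous_lt_locally _ _ z (continuous_Cmod z) (continuous_const y z) Hy).
    eapply filter_imp with (2 := H). intros w Hw _. exact Hw. }
  assert (Hm1 : m z0 <= m z1) by (now apply Hmax).
  assert (Hd2 := Hdisk z2 Hz2).
  assert (Hz2r : Cmod z2 < r).
  { destruct Hz2 as [Hz2|Hz2]; [exact Hz2|exfalso].
    assert (H1 := HAB z2 Hd2). rewrite (HmA z2 Hd2), Hm2, Hz2 in H1.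
    assert (H2 := HBpos z2 Hd2).
    assert (H3 : 1 < r * m z1).
    { rewrite <- (Rinv_l (m z0)) by lra. nra. }
    nra. }
  set (q := (A z2 / B z2)%C).
  assert (Hq : Cmod q = m z1).
  { unfold q. rewrite Cmod_div by (apply HB0, Hd2). exact Hm2. }
  assert (Hnear : locally z2 (fun w => Cmod w <= r)).
  { assert (H := continuous_lt_locally _ _ z2 (continuous_Cmod z2) (continuous_const r z2) Hz2r).
    eapply filter_imp with (2 := H). intros w Hw. cbv beta in Hw. lra. }
  assert (Hloc : locally z2 (fun w => A w = (q * B w)%C)).
  { apply analytic_at_local_max.
    - apply HA, Hd2.
    - apply HB, Hd2.
    - unfold q. field. apply HB0, Hd2.
    - apply Cmod_gt_0. rewrite (HmA z2 Hd2). apply Rmult_lt_0_compat; [lra|now apply HBpos].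
    - eapply filter_imp with (2 := Hnear). intros w Hw.
      rewrite Hq, (HmA w (Hdisk w Hw)). apply Rmult_le_compat_r; [apply Cmod_ge_0|now apply Hmax]. }
  (* The radial direction increases the modulus; at the origin every direction does. *)
  set (u := if Ceq_dec z2 (RtoC 0) then RtoC 1 else z2).
  destruct (locally_C_ray z2 u _ (filter_and _ _ Hnear Hloc)) as (rho & Hrho & Hw1 & Hw2).
  set (w := (z2 + RtoC rho * u)%C) in *.
  assert (Hw : Cmod w <= Cmod z2).
  { apply Hmax2. split; [exact Hw1|].
    change (Cmod (A w) * / Cmod (B w) = m z1). rewrite Hw2, Cmod_mult, Hq. specialize (HBpos w (Hdisk w Hw1)). field. lra. }
  unfold w, u in Hw. destruct (Ceq_dec z2 (RtoC 0)) as [->|Hne].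
  - rewrite Cplus_0_l, Cmult_1_r, Cmod_0, Cmod_R, Rabs_pos_eq in Hw; lra.
  - replace (z2 + RtoC rho * z2)%C with (RtoC (1 + rho) * z2)%C in Hw by (rewrite RtoC_plus; ring).
    rewrite Cmod_mult, Cmod_R, Rabs_pos_eq in Hw by lra.
    apply Cmod_gt_0 in Hne. nra.
Qed.

(** As [1 - |z|^2 > 0] on the disk, the excess of the left side over [c^2] has the sign of
    [|p|^2 - |c + z p|^2]. *)
Lemma Cmod2_minus_conj (c : R) (z p : C) :
  Cmod (RtoC (1 - Cmod z ^ 2) * p - RtoC c * Cconj z)%C ^ 2
  = c ^ 2 + (1 - Cmod z ^ 2) * (Cmod p ^ 2 - Cmod (RtoC c + z * p)%C ^ 2).
Proof.
  rewrite !Cmod2_alt. destruct z, p. unfold Re, Im. simpl. ring.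
Qed.

Lemma Cmod2_const_plus (c : R) (w : C) :
  Cmod (RtoC c + w)%C ^ 2 = c ^ 2 + 2 * c * Re w + Cmod w ^ 2.
Proof.
  rewrite !Cmod2_alt. destruct w. unfold Re, Im. simpl. ring.
Qed.

Lemma Rlt_pow2 (x y : R) : 0 <= x -> x < y -> x ^ 2 < y ^ 2.
Proof. intros. nra. Qed.

Lemma unit_disk_Cmod2 (z : C) : unit_disk z -> 0 < 1 - Cmod z ^ 2.
Proof. intros hz. unfold unit_disk in hz. pose proof (Cmod_ge_0 z). nra. Qed.

Lemma circle_iff_Cmod_le (c : R) (z p : C) :
  0 < c -> unit_disk z ->
  (Cmod (RtoC (1 - Cmod z ^ 2) * p - RtoC c * Cconj z)%C <= c <->
   Cmod p <= Cmod (RtoC c + z * p)%C).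
Proof.
  intros hc hz. assert (H0 := unit_disk_Cmod2 z hz). assert (E := Cmod2_minus_conj c z p).
  split; intros H; apply Rnot_lt_le; intros Hlt.
  - assert (H1 : Cmod (RtoC c + z * p)%C ^ 2 < Cmod p ^ 2) by (apply Rlt_pow2; auto using Cmod_ge_0).
    assert (H2 := pow_incr _ _ 2 (conj (Cmod_ge_0 _) H)).
    assert (0 < (1 - Cmod z ^ 2) * (Cmod p ^ 2 - Cmod (RtoC c + z * p)%C ^ 2))
      by (apply Rmult_lt_0_compat; lra).
    lra.
  - assert (H1 := pow_incr _ _ 2 (conj (Cmod_ge_0 _) H)).
    apply Rlt_pow2 in Hlt; [|lra].
    assert (0 <= (1 - Cmod z ^ 2) * (Cmod (RtoC c + z * p)%C ^ 2 - Cmod p ^ 2))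
      by (apply Rmult_le_pos; lra).
    lra.
Qed.

Lemma Cmod_le_Re_ge (c : R) (z p : C) :
  0 < c -> unit_disk z ->
  Cmod p <= Cmod (RtoC c + z * p)%C ->
  Re (1 + z * p)%C >= 1 - c / 2 + (1 - Cmod z ^ 2) / (2 * c) * Cmod (z * p)%C ^ 2.
Proof.
  intros hc hz H. assert (H0 := unit_disk_Cmod2 z hz).
  assert (Hsq : Cmod p ^ 2 <= Cmod (RtoC c + z * p)%C ^ 2).
  { apply pow_incr. split; [apply Cmod_ge_0|exact H]. }
  rewrite Cmod2_const_plus, Cmod_mult in Hsq. rewrite re_plus, re_RtoC, Cmod_mult.
  set (x := Re (z * p)%C) in *. set (s := Cmod z) in *. set (t := Cmod p) in *.
  apply Rle_ge, (Rmult_le_reg_l (2 * c)); [lra|].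
  replace (2 * c * (1 - c / 2 + (1 - s ^ 2) / (2 * c) * (s * t) ^ 2))
    with (2 * c - c ^ 2 + (1 - s ^ 2) * (s ^ 2 * t ^ 2)) by (field; lra).
  pose proof (pow2_ge_0 s). pose proof (pow2_ge_0 t).
  (* The hypothesis reads [(1 - s^2) t^2 <= c^2 + 2 c x], and the goal has [(1 - s^2) s^2 t^2] on
     the left; this product is the difference. *)
  assert (0 <= (1 - s ^ 2) * ((1 - s ^ 2) * t ^ 2)) by (apply Rmult_le_pos; [lra|apply Rmult_le_pos; lra]).
  nra.
Qed.

Lemma Re_ge_Re_gt (c : R) (z p : C) :
  0 < c -> unit_disk z ->
  Re (1 + z * p)%C >= 1 - c / 2 + (1 - Cmod z ^ 2) / (2 * c) * Cmod (z * p)%C ^ 2 ->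
  Re (1 + z * p)%C > 1 - c / 2.
Proof.
  intros hc hz H. assert (H0 := unit_disk_Cmod2 z hz).
  destruct (Ceq_dec (z * p)%C (RtoC 0)) as [E|E].
  - rewrite E, re_plus, !re_RtoC. lra.
  - apply Cmod_gt_0 in E.
    assert (0 < (1 - Cmod z ^ 2) / (2 * c) * Cmod (z * p)%C ^ 2).
    { apply Rmult_lt_0_compat; [apply Rdiv_lt_0_compat; lra|apply pow_lt, E]. }
    lra.
Qed.

(** Schwarz' lemma is applied to [f''] and [B = c f' + z f'']; the common factor [f'] cancels at the
    end. The strict inequality [Hlt] also shows that [B] has no zero. *)
Lemma class_F_Cmod_le (c : R) (f : C -> C) :
  0 < c -> class_F c f ->
  forall z, unit_disk z -> Cmod (pre_schwarzian f z) <= Cmod (RtoC c + z * pre_schwarzian f z)%C.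
Proof.
  intros hc (HA & Hnv & HF).
  set (f1 := C_derive f). set (f2 := C_derive f1).
  assert (Hf1 : analytic_on unit_disk f1).
  { intros z Hz. apply analytic_at_derive, HA, Hz. }
  assert (Hf2 : analytic_on unit_disk f2).
  { intros z Hz. apply analytic_at_derive, Hf1, Hz. }
  set (B := fun z => (RtoC c * f1 z + z * f2 z)%C).
  assert (HfB : forall z, unit_disk z -> B z = (f1 z * (RtoC c + z * pre_schwarzian f z))%C).
  { intros z Hz. unfold B, pre_schwarzian. fold f1 f2. field. apply Hnv, Hz. }
  assert (HfA : forall z, unit_disk z -> f2 z = (f1 z * pre_schwarzian f z)%C).
  { intros z Hz. unfold pre_schwarzian. fold f1 f2. field. apply Hnv, Hz. }
  (* With [w = z p], [|c + w|^2 - |w|^2 = c (c + 2 Re w)], which is positive since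
     [Re w > - c / 2]. *)
  assert (Hlt : forall z, unit_disk z ->
    Cmod (z * pre_schwarzian f z)%C < Cmod (RtoC c + z * pre_schwarzian f z)%C).
  { intros z Hz. specialize (HF z Hz). rewrite re_plus, re_RtoC in HF.
    assert (E := Cmod2_const_plus c (z * pre_schwarzian f z)%C).
    apply Rnot_le_lt. intros Hle.
    assert (Cmod (RtoC c + z * pre_schwarzian f z)%C ^ 2 <= Cmod (z * pre_schwarzian f z)%C ^ 2).
    { apply pow_incr. split; [apply Cmod_ge_0|exact Hle]. }
    nra. }
  intros z Hz.
  assert (H : Cmod (f2 z) <= Cmod (B z)).
  { revert z Hz. apply schwarz_quotient.
    - exact Hf2.
    - intros z Hz. apply analytic_at_plus.
      + apply analytic_at_scal, Hf1, Hz.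
      + apply analytic_at_mul_id, Hf2, Hz.
    - intros z Hz. rewrite (HfB z Hz). apply Cmult_neq_0; [apply Hnv, Hz|].
      apply Cmod_gt_0. eapply Rle_lt_trans; [|apply (Hlt z Hz)]. apply Cmod_ge_0.
    - intros z Hz. rewrite (HfB z Hz), (HfA z Hz), <- Cmod_mult.
      replace (z * (f1 z * pre_schwarzian f z))%C with (f1 z * (z * pre_schwarzian f z))%C by ring.
      rewrite !(Cmod_mult (f1 z)). apply Rmult_le_compat_l; [apply Cmod_ge_0|].
      left. apply Hlt, Hz. }
  rewrite (HfB z Hz), (HfA z Hz), !(Cmod_mult (f1 z)) in H.
  apply Rmult_le_reg_l with (2 := H). apply Cmod_gt_0, Hnv, Hz.
Qed.

(** * The extremal function *)

Lemma converges_on_disk_sum (a : nat -> C) (r : R) :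
  converges_on_disk a r -> exists F : C -> C, forall h, Cmod h < r -> is_Cpseries a h (F h).
Proof.
  intros Ha. exists (fun h => epsilon (inhabits (RtoC 0)) (fun l => is_Cpseries a h l)).
  intros h Hh. apply epsilon_spec. exact (Ha h Hh).
Qed.

(** Integrating the series of [g] termwise, with constant term [F z0], gives a sum with the same
    derivative as [F] and the same value at [z0]. Dividing by [n + 1] only shrinks the coefficients,
    so convergence persists. *)
Lemma analytic_at_antiderivative (F g : C -> C) (z0 : C) (r : R) :
  0 < r -> (forall z, Cmod (z - z0)%C < r -> has_deriv F z (g z)) ->
  analytic_at g z0 -> analytic_at F z0.
Proof.
  intros Hr HF (s & b & Hb).
  set (a := fun n => match n with O => F z0 | S n => (/ RtoC (INR (S n)) * b n)%C end).
  assert (HS : forall n, RtoC (INR (S n)) <> RtoC 0).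
  { intros n H. apply RtoC_inj in H. now apply (not_0_INR (S n)). }
  assert (Hconv : converges_on_disk a s).
  { intros h Hh.
    apply (ex_series_incr_1 (K := C_AbsRing) (V := C_NormedModule)).
    assert (Hbc : converges_on_disk b s).
    { intros k Hk. exists (g (z0 + k)%C). now apply analytic_at_shift with s. }
    apply CV_radius_Cmod_ge in Hbc.
    apply (ex_series_Cmod (fun n => (h ^ S n * a (S n))%C)
             (fun n => Cmod h * Rabs (Cmod (b n) * Cmod h ^ n))).
    - intros n. rewrite Cpow_S, !Cmod_mult, Cmod_pow. unfold a.
      rewrite Cmod_mult, Cmod_inv by apply HS.
      rewrite Cmod_R, Rmult_assoc. apply Rmult_le_compat_l; [apply Cmod_ge_0|].
      assert (H1 : 1 <= INR (S n)) by (rewrite S_INR; pose proof (pos_INR n); lra).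
      rewrite (Rabs_pos_eq (INR (S n))) by lra.
      rewrite Rabs_pos_eq by (apply Rmult_le_pos; [|apply pow_le]; apply Cmod_ge_0).
      assert (H2 : / INR (S n) <= 1) by (rewrite <- Rinv_1; apply Rinv_le_contravar; lra).
      assert (H3 : 0 <= Cmod (b n) * Cmod h ^ n)
        by (apply Rmult_le_pos; [|apply pow_le]; apply Cmod_ge_0).
      replace (Cmod h ^ n * (/ INR (S n) * Cmod (b n)))
        with (/ INR (S n) * (Cmod (b n) * Cmod h ^ n)) by ring. nra.
    - apply (ex_series_scal (V := R_NormedModule)). apply CV_disk_inside.
      apply Rbar_lt_le_trans with (2 := Hbc).
      simpl. rewrite Rabs_pos_eq by apply Cmod_ge_0. exact Hh. }
  destruct (converges_on_disk_sum a s Hconv) as [S HSum].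
  assert (HSd : forall z, Cmod (z - z0)%C < s -> has_deriv (fun w => S (w - z0)%C) z (g z)).
  { intros z Hz. apply has_deriv_shift.
    destruct (is_Cpseries_has_deriv a s S _ HSum Hz) as (d & Hd & HSd).
    replace (g z) with d; [exact HSd|].
    apply (is_Cseries_unique _ _ _ Hd).
    eapply is_series_ext; [|exact (Hb z Hz)]. intros n. cbv beta. f_equal.
    unfold Cderiv_coeff, a. rewrite Cmult_assoc, Cinv_r by apply HS. symmetry; apply Cmult_1_l. }
  set (t := Rmin r s). assert (Ht : 0 < t) by (apply Rmin_pos; [exact Hr|apply cond_pos]).
  exists (mkposreal t Ht), a. simpl. intros z Hz.
  assert (Hz' := Rlt_le_trans _ _ _ Hz (Rmin_r _ _)).
  replace (F z) with (S (z - z0)%C); [now apply HSum|].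
  assert (Hc : (F z + RtoC (-1) * S (z - z0))%C = (F z0 + RtoC (-1) * S (z0 - z0))%C).
  { apply (has_deriv_zero_const (fun w => (F w + RtoC (-1) * S (w - z0))%C) z0 t); [|exact Hz].
    intros w Hw.
    assert (H := has_deriv_plus _ _ _ _ _ (HF w (Rlt_le_trans _ _ _ Hw (Rmin_l _ _)))
      (has_deriv_mult _ _ _ _ _ (has_deriv_const (RtoC (-1)) w)
         (HSd w (Rlt_le_trans _ _ _ Hw (Rmin_r _ _))))).
    replace (RtoC 0) with (g w + (0 * S (w - z0) + RtoC (-1) * g w))%C by ring. exact H. }
  replace (z0 - z0)%C with (RtoC 0) in Hc by ring.
  rewrite (is_Cseries_unique _ _ _ (HSum (RtoC 0) ltac:(rewrite Cmod_0; apply cond_pos))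
             (is_Cpseries_0 a)) in Hc.
  replace (F z0 + RtoC (-1) * a 0%nat)%C with (RtoC 0) in Hc by (simpl; ring).
  replace (F z) with ((F z + RtoC (-1) * S (z - z0)) + S (z - z0))%C by ring.
  rewrite Hc. ring.
Qed.

Lemma Re_one_minus_pos (z : C) : unit_disk z -> 0 < Re (1 - z)%C.
Proof.
  intros Hz. unfold unit_disk in Hz.
  assert (H := Rle_lt_trans _ _ _ (re_le_Cmod z) Hz). apply Rabs_def2 in H.
  destruct z. unfold Re in *; simpl in *. lra.
Qed.

Lemma one_minus_neq_0 (z : C) : unit_disk z -> (1 - z)%C <> RtoC 0.
Proof.
  intros Hz H. apply Re_one_minus_pos in Hz. rewrite H, re_RtoC in Hz. lra.
Qed.

(** On the disk [Re (1 - z) > 0], so [Carg] stays in its first branch and the claim is real calculus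
    for [ln] and [atan]. *)
Lemma has_deriv_Clog_one_minus (z : C) :
  unit_disk z -> has_deriv (fun w => Clog (1 - w)%C) z (RtoC (-1) / (1 - z))%C.
Proof.
  intros Hz.
  assert (Hre := Re_one_minus_pos z Hz).
  apply has_deriv_ext_loc with
    (F := fun w => (ln (Cmod (1 - w)%C), atan (Im (1 - w)%C / Re (1 - w)%C))) (delta := 1 - Cmod z).
  - unfold unit_disk in Hz. lra.
  - intros h Hh. unfold Clog, Carg.
    assert (Hzh : unit_disk (z + h)%C).
    { unfold unit_disk. eapply Rle_lt_trans; [apply Cmod_triangle|lra]. }
    destruct (Rlt_dec 0 (Re (1 - (z + h))%C)) as [H|H]; [reflexivity|].
    now apply Re_one_minus_pos in Hzh.
  - intros v. destruct z as [x y], v as [p q]. unfold Re in Hre. simpl in Hre.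
    assert (Hx : 0 < 1 - x) by lra.
    assert (Hn : 0 < (1 - x) ^ 2 + y ^ 2) by nra.
    assert (Hval : ((p, q) * (RtoC (-1) / (1 - (x, y))))%C =
      (- (p * (1 - x) - q * y) / ((1 - x) ^ 2 + y ^ 2),
       - (p * y + q * (1 - x)) / ((1 - x) ^ 2 + y ^ 2))).
    { apply injective_projections; simpl; field; nra. }
    rewrite Hval.
    split.
    + apply (is_derive_ext (fun t => ln (sqrt ((1 - (x + t * p)) ^ 2 + (y + t * q) ^ 2)))).
      { intros t. unfold Re, Im, Cmod. simpl. do 2 f_equal. ring. }
      assert (Hs : 0 < sqrt ((1 - (x + 0 * p)) ^ 2 + (y + 0 * q) ^ 2)).
      { apply sqrt_lt_R0. rewrite !Rmult_0_l, !Rplus_0_r. exact Hn. }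
      auto_derive.
      * repeat split; [|exact Hs]. rewrite !Rmult_0_l, !Rplus_0_r. simpl in Hn. lra.
      * rewrite !Rmult_0_l, !Rplus_0_r in *.
        assert (Hsq := sqrt_sqrt ((1 - x) ^ 2 + y ^ 2) (Rlt_le _ _ Hn)).
        replace ((1 + - x) * ((1 + - x) * 1) + y * (y * 1)) with ((1 - x) ^ 2 + y ^ 2) by ring.
        unfold Re; cbn [fst]. rewrite <- Hsq at 3.
        field. lra.
    + apply (is_derive_ext (fun t => atan (- (y + t * q) / (1 - (x + t * p))))).
      { intros t. unfold Re, Im. simpl. do 2 f_equal; ring. }
      auto_derive.
      * rewrite !Rmult_0_l, !Rplus_0_r. lra.
      * unfold Im; cbn [snd]. field. repeat split; try lra; nra.
Qed.

(** * Real powers of [1 - z] and their binomial series *)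

Lemma Cexp_plus (x y : C) : Cexp (x + y)%C = (Cexp x * Cexp y)%C.
Proof.
  destruct x, y. unfold Cexp, Re, Im. apply injective_projections; simpl;
    rewrite exp_plus, ?cos_plus, ?sin_plus; ring.
Qed.

Lemma Cexp_0 : Cexp (RtoC 0) = RtoC 1.
Proof.
  unfold Cexp, Re, Im. simpl. rewrite exp_0, cos_0, sin_0.
  apply injective_projections; simpl; ring.
Qed.

Lemma Crpow_plus (w : C) (a b : R) : Crpow w (a + b) = (Crpow w a * Crpow w b)%C.
Proof.
  unfold Crpow. rewrite <- Cexp_plus, RtoC_plus. f_equal. ring.
Qed.

Lemma Crpow_0 (w : C) : Crpow w 0 = RtoC 1.
Proof. unfold Crpow. now rewrite Cmult_0_l, Cexp_0. Qed.

Lemma Crpow_opp (w : C) (a : R) : (Crpow w a * Crpow w (- a))%C = RtoC 1.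
Proof. now rewrite <- Crpow_plus, Rplus_opp_r, Crpow_0. Qed.

Lemma Crpow_neq_0 (w : C) (a : R) : Crpow w a <> RtoC 0.
Proof.
  intros H. assert (H1 := Crpow_opp w a). rewrite H, Cmult_0_l in H1.
  apply RtoC_inj in H1. lra.
Qed.

Lemma Clog_1 : Clog (RtoC 1) = RtoC 0.
Proof.
  unfold Clog, Carg. rewrite Cmod_1, ln_1. simpl.
  destruct (Rlt_dec 0 1) as [H|H]; [|lra].
  unfold Rdiv. rewrite Rmult_0_l, atan_0. reflexivity.
Qed.

Lemma Crpow_1 (a : R) : Crpow (RtoC 1) a = RtoC 1.
Proof. unfold Crpow. now rewrite Clog_1, Cmult_0_r, Cexp_0. Qed.

Lemma has_deriv_Crpow_one_minus (a : R) (z : C) :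
  unit_disk z ->
  has_deriv (fun w => Crpow (1 - w)%C a) z (RtoC (- a) / (1 - z) * Crpow (1 - z)%C a)%C.
Proof.
  intros Hz.
  assert (H := has_deriv_Cexp _ _ _ (has_deriv_mult _ _ _ _ _
    (has_deriv_const (RtoC a) z) (has_deriv_Clog_one_minus z Hz))).
  cbv beta in H. fold (Crpow (1 - z)%C a) in H.
  replace (RtoC (- a) / (1 - z))%C with (0 * Clog (1 - z) + RtoC a * (RtoC (-1) / (1 - z)))%C;
    [exact H|].
  rewrite RtoC_opp. field. now apply one_minus_neq_0.
Qed.

(** The product of [1 - z] and this power has derivative 0 and equals 1 at the origin, so
    [Cexp (Clog w) = w] need not be computed in components. *)
Lemma Crpow_one_minus_m1 (z : C) : unit_disk z -> Crpow (1 - z)%C (-1) = (/ (1 - z))%C.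
Proof.
  intros Hz.
  assert (Hc : ((1 + RtoC (-1) * z) * Crpow (1 - z)%C (-1))%C
               = ((1 + RtoC (-1) * 0) * Crpow (1 - 0)%C (-1))%C).
  { apply (has_deriv_zero_const (fun w => ((1 + RtoC (-1) * w) * Crpow (1 - w) (-1))%C) (RtoC 0) 1).
    - intros w Hw. replace (w - 0)%C with w in Hw by ring.
      assert (H := has_deriv_mult _ _ _ _ _
        (has_deriv_plus _ _ _ _ _ (has_deriv_const (RtoC 1) w)
          (has_deriv_mult _ _ _ _ _ (has_deriv_const (RtoC (-1)) w) (has_deriv_id w)))
        (has_deriv_Crpow_one_minus (-1) w Hw)).
      cbv beta in H. evar (d : C). replace (RtoC 0) with d; [exact H|]. unfold d.
      replace (RtoC (- -1)) with (RtoC 1) by (f_equal; ring).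
      field. now apply one_minus_neq_0.
    - now replace (z - 0)%C with z by ring. }
  replace (1 - 0)%C with (RtoC 1) in Hc by ring. rewrite Crpow_1 in Hc.
  assert (Hne := one_minus_neq_0 z Hz).
  replace (Crpow (1 - z)%C (-1)) with (/ (1 - z) * ((1 + RtoC (-1) * z) * Crpow (1 - z)%C (-1)))%C
    by (field; exact Hne).
  rewrite Hc. field. exact Hne.
Qed.

(** These are the Taylor coefficients of [(1 - h / w)^a] in powers of [h]. *)
Fixpoint binomial_coeff (a : R) (w : C) (n : nat) : C :=
  match n with
  | O => RtoC 1
  | S n => (RtoC ((INR n - a) / INR (S n)) / w * binomial_coeff a w n)%C
  end.

(** Each ratio [|n - a| / (n + 1)] is at most [1 + |a|]. The resulting geometric bound is crude, but
    any positive radius of convergence suffices. *)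
Lemma binomial_coeff_bound (a : R) (w : C) (n : nat) :
  w <> RtoC 0 -> Cmod (binomial_coeff a w n) <= ((1 + Rabs a) / Cmod w) ^ n.
Proof.
  intros Hw. assert (Hw' := proj1 (Cmod_gt_0 w) Hw).
  assert (Ha := Rabs_pos a).
  induction n as [|n IH]; [simpl; rewrite Cmod_1; lra|].
  cbn [binomial_coeff pow]. rewrite Cmod_mult.
  apply Rmult_le_compat; try apply Cmod_ge_0; [|exact IH].
  rewrite Cmod_div, Cmod_R by exact Hw.
  apply Rmult_le_compat_r; [left; now apply Rinv_0_lt_compat|].
  assert (Hn := pos_INR n). rewrite S_INR.
  rewrite Rabs_div by lra. rewrite (Rabs_pos_eq (INR n + 1)) by lra.
  apply Rle_div_l; [lra|].
  apply Rle_trans with (INR n + Rabs a); [|nra].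
  eapply Rle_trans; [apply Rabs_triang|]. rewrite Rabs_Ropp, (Rabs_pos_eq (INR n)) by exact Hn. lra.
Qed.

(* The coefficients are those for which the sum [H] solves [(1 - z) H' = - a H], the
   equation of [Crpow (1 - z) a]. *)
Lemma analytic_at_Crpow_one_minus (a : R) (z0 : C) :
  unit_disk z0 -> analytic_at (fun z => Crpow (1 - z)%C a) z0.
Proof.
  intros Hz0. assert (Hne := one_minus_neq_0 z0 Hz0). set (w0 := (1 - z0)%C) in *.
  assert (Hw0 := proj1 (Cmod_gt_0 w0) Hne).
  set (q := (1 + Rabs a) / Cmod w0).
  assert (Hq : 0 < q) by (apply Rdiv_lt_0_compat; pose proof (Rabs_pos a); lra).
  assert (Hconv : converges_on_disk (binomial_coeff a w0) (/ q)).
  { intros h Hh.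
    apply (ex_series_Cmod (fun n => (h ^ n * binomial_coeff a w0 n)%C) (fun n => (Cmod h * q) ^ n)).
    - intros n. rewrite Cmod_mult, Cmod_pow, Rpow_mult_distr.
      apply Rmult_le_compat_l; [apply pow_le, Cmod_ge_0|]. now apply binomial_coeff_bound.
    - apply ex_series_geom. rewrite Rabs_pos_eq.
      + apply Rmult_lt_compat_r with (1 := Hq) in Hh. rewrite Rinv_l in Hh; lra.
      + apply Rmult_le_pos; [apply Cmod_ge_0|lra]. }
  destruct (converges_on_disk_sum _ _ Hconv) as [H HH].
  assert (Hode : forall h, Cmod h < / q -> exists d, has_deriv H h d /\ ((w0 - h) * d)%C = (RtoC (- a) * H h)%C).
  { intros h Hh. destruct (is_Cpseries_has_deriv _ _ H h HH Hh) as (d & Hd & HHd).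
    exists d. split; [exact HHd|].
    assert (S1 := is_pseries_scal (K := C_AbsRing) (V := C_NormedModule) w0 _ h _ (Cmult_comm _ _) Hd).
    assert (S2 := is_pseries_incr_1 (K := C_AbsRing) (V := C_NormedModule) _ h _ Hd).
    assert (S3 := is_pseries_scal (K := C_AbsRing) (V := C_NormedModule) (RtoC (- a)) _ h _ (Cmult_comm _ _) (HH h Hh)).
    assert (S4 := is_Cseries_minus _ _ _ _ S1 S2).
    replace ((w0 - h) * d)%C with (w0 * d - h * d)%C by ring.
    apply (is_Cseries_unique _ _ _ S4). eapply is_series_ext; [|exact S3].
    intros n.
    match goal with |- ?x = ?y => change (@eq C x y) end.
    change (h ^ n * (RtoC (- a) * binomial_coeff a w0 n)
      = h ^ n * (w0 * (RtoC (INR (S n)) * binomial_coeff a w0 (S n)))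
        - h ^ n * PS_incr_1 (K := C_AbsRing) (V := C_NormedModule) (Cderiv_coeff (binomial_coeff a w0)) n)%C.
    replace (PS_incr_1 (K := C_AbsRing) (V := C_NormedModule) (Cderiv_coeff (binomial_coeff a w0)) n)
      with (RtoC (INR n) * binomial_coeff a w0 n)%C
      by (destruct n; [exact (Cmult_0_l _)|reflexivity]).
    cbn [binomial_coeff].
    assert (HS : RtoC (INR (S n)) <> RtoC 0).
    { intros E. apply RtoC_inj in E. now apply (not_0_INR (S n)). }
    unfold Rdiv. rewrite RtoC_mult, RtoC_inv, RtoC_minus, RtoC_opp by (now apply not_0_INR).
    field. split; assumption. }
  set (r := Rmin (/ q) (1 - Cmod z0)).
  assert (Hr : 0 < r).
  { apply Rmin_pos; [now apply Rinv_0_lt_compat|unfold unit_disk in Hz0; lra]. }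
  exists (mkposreal r Hr).
  exists (PS_scal (K := C_AbsRing) (V := C_NormedModule) (Crpow w0 a) (binomial_coeff a w0)).
  simpl. intros z Hz.
  assert (Hr1 : forall w, Cmod (w - z0)%C < r -> Cmod (w - z0)%C < / q).
  { intros w Hw. apply Rlt_le_trans with (1 := Hw), Rmin_l. }
  assert (Hr2 : forall w, Cmod (w - z0)%C < r -> unit_disk w).
  { intros w Hw. unfold unit_disk. replace w with ((w - z0) + z0)%C by ring.
    eapply Rle_lt_trans; [apply Cmod_triangle|].
    assert (K := Rlt_le_trans _ _ _ Hw (Rmin_r _ _)). lra. }
  (* Multiplying [H] by the power with exponent [- a] avoids a quotient; the equation for [H] makes
     the derivative of the product vanish. Since [H] is 1 at 0, it is [(1 - z)^a] divided by
     [w0^a]. *)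
  assert (Hc : (H (z - z0) * Crpow (1 - z) (- a))%C = (H (z0 - z0) * Crpow (1 - z0) (- a))%C).
  { apply (has_deriv_zero_const (fun w => (H (w - z0) * Crpow (1 - w) (- a))%C) z0 r); [|exact Hz].
    intros w Hw. destruct (Hode _ (Hr1 w Hw)) as (d & Hd & Hde).
    apply has_deriv_shift in Hd.
    assert (HD := has_deriv_mult _ _ _ _ _ Hd (has_deriv_Crpow_one_minus (- a) w (Hr2 w Hw))).
    cbv beta in HD. evar (l : C). replace (RtoC 0) with l; [exact HD|]. unfold l.
    assert (Hw1 := one_minus_neq_0 w (Hr2 w Hw)).
    replace (w0 - (w - z0))%C with (1 - w)%C in Hde by (unfold w0; ring).
    replace d with (/ (1 - w) * (RtoC (- a) * H (w - z0)))%C by (rewrite <- Hde; field; exact Hw1).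
    rewrite !RtoC_opp. field. exact Hw1. }
  replace (z0 - z0)%C with (RtoC 0) in Hc by ring.
  rewrite (is_Cseries_unique _ _ _ (HH (RtoC 0) ltac:(rewrite Cmod_0; now apply Rinv_0_lt_compat))
             (is_Cpseries_0 _)) in Hc.
  cbn [binomial_coeff] in Hc. fold w0 in Hc.
  replace (Crpow (1 - z)%C a) with (Crpow w0 a * H (z - z0))%C.
  - apply (is_pseries_scal (K := C_AbsRing) (V := C_NormedModule)); [apply Cmult_comm|].
    apply HH, Hr1, Hz.
  - transitivity (Crpow w0 a * H (z - z0) * (Crpow (1 - z) a * Crpow (1 - z) (- a)))%C;
      [rewrite Crpow_opp; ring|].
    transitivity (Crpow w0 a * (H (z - z0) * Crpow (1 - z) (- a)) * Crpow (1 - z) a)%C; [ring|].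
    rewrite Hc.
    transitivity ((Crpow w0 a * Crpow w0 (- a)) * Crpow (1 - z) a)%C; [ring|].
    rewrite Crpow_opp. ring.
Qed.

Lemma has_deriv_f_extremal (c : R) (z : C) :
  unit_disk z -> has_deriv (f_extremal c) z (Crpow (1 - z)%C (- c)).
Proof.
  intros Hz. assert (Hne := one_minus_neq_0 z Hz). unfold f_extremal.
  destruct (Req_EM_T c 1) as [->|Hc].
  - assert (H := has_deriv_mult _ _ _ _ _ (has_deriv_const (RtoC (-1)) z) (has_deriv_Clog_one_minus z Hz)).
    cbv beta in H. rewrite Crpow_one_minus_m1 by exact Hz.
    replace (/ (1 - z))%C with (0 * Clog (1 - z) + RtoC (-1) * (RtoC (-1) / (1 - z)))%C
      by (field; exact Hne).
    apply has_deriv_ext_loc with (3 := H) (delta := 1); [lra|]. intros h _. ring.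
  - assert (Hc' : RtoC (c - 1) <> RtoC 0) by (intros E; apply RtoC_inj in E; lra).
    assert (H := has_deriv_mult _ _ _ _ _ (has_deriv_const (/ RtoC (c - 1))%C z)
      (has_deriv_plus _ _ _ _ _ (has_deriv_Crpow_one_minus (1 - c) z Hz) (has_deriv_const (RtoC (-1)) z))).
    cbv beta in H.
    apply has_deriv_ext_loc with (G := fun w => ((Crpow (1 - w) (1 - c) - 1) / RtoC (c - 1))%C)
      (delta := 1) in H; [|lra|intros h _; field; exact Hc'].
    evar (l : C). replace (Crpow (1 - z)%C (- c)) with l; [exact H|]. unfold l.
    replace (- c) with (1 - c + -1) by ring.
    rewrite Crpow_plus, Crpow_one_minus_m1 by exact Hz.
    replace (RtoC (- (1 - c))) with (RtoC (c - 1)) by (f_equal; ring).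
    field. split; assumption.
Qed.

Lemma C_derive_f_extremal (c : R) (z : C) :
  unit_disk z -> C_derive (f_extremal c) z = Crpow (1 - z)%C (- c).
Proof. intros Hz. now apply has_deriv_C_derive, has_deriv_f_extremal. Qed.

Lemma pre_schwarzian_f_extremal (c : R) (z : C) :
  unit_disk z -> pre_schwarzian (f_extremal c) z = (RtoC c / (1 - z))%C.
Proof.
  intros Hz. unfold pre_schwarzian.
  assert (H2 : C_derive (C_derive (f_extremal c)) z = (RtoC c / (1 - z) * Crpow (1 - z) (- c))%C).
  { apply has_deriv_C_derive.
    assert (H := has_deriv_Crpow_one_minus (- c) z Hz). rewrite Ropp_involutive in H.
    apply has_deriv_ext_loc with (3 := H) (delta := 1 - Cmod z).
    - unfold unit_disk in Hz; lra.
    - intros h Hh. symmetry. apply C_derive_f_extremal. unfold unit_disk.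
      eapply Rle_lt_trans; [apply Cmod_triangle|lra]. }
  rewrite H2, C_derive_f_extremal by exact Hz. field. split; [now apply one_minus_neq_0|apply Crpow_neq_0].
Qed.

Lemma f_extremal_class_F (c : R) : 0 < c -> class_F c (f_extremal c).
Proof.
  intros hc.
  assert (H0 : unit_disk (RtoC 0)) by (unfold unit_disk; rewrite Cmod_0; lra).
  assert (H10 : (1 - 0)%C = RtoC 1) by ring.
  split; [split; [|split]|split].
  - intros z0 Hz0. apply analytic_at_antiderivative with (fun z => Crpow (1 - z)%C (- c)) (1 - Cmod z0).
    + unfold unit_disk in Hz0. lra.
    + intros z Hz. apply has_deriv_f_extremal. unfold unit_disk.
      replace z with ((z - z0) + z0)%C by ring. eapply Rle_lt_trans; [apply Cmod_triangle|lra].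
    + now apply analytic_at_Crpow_one_minus.
  - unfold f_extremal. rewrite H10, Clog_1, Crpow_1.
    destruct (Req_EM_T c 1) as [_|Hc]; [ring|].
    field. intros E. apply RtoC_inj in E. lra.
  - rewrite C_derive_f_extremal, H10 by exact H0. apply Crpow_1.
  - intros z Hz. rewrite C_derive_f_extremal by exact Hz. apply Crpow_neq_0.
  - intros z Hz. rewrite pre_schwarzian_f_extremal by exact Hz.
    assert (Hre := Re_one_minus_pos z Hz). assert (H1 := unit_disk_Cmod2 z Hz).
    rewrite Cmod2_alt in H1. destruct z as [x y]. unfold Re, Im in *. simpl in *.
    (* After clearing [|1 - z|^2], the claim reduces to [x (1 - x) - y^2 + |1 - z|^2 / 2 = (1 -
       |z|^2) / 2 > 0]. *)
    match goal with |- ?l > _ =>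
      replace l with (1 + c * (x * (1 - x) - y ^ 2) / ((1 - x) ^ 2 + y ^ 2)) by (field; nra) end.
    assert (Hn : 0 < (1 - x) ^ 2 + y ^ 2) by nra.
    apply Rlt_gt, (Rmult_lt_reg_r ((1 - x) ^ 2 + y ^ 2)); [exact Hn|].
    replace ((1 + c * (x * (1 - x) - y ^ 2) / ((1 - x) ^ 2 + y ^ 2)) * ((1 - x) ^ 2 + y ^ 2))
      with ((1 - x) ^ 2 + y ^ 2 + c * (x * (1 - x) - y ^ 2)) by (field; lra).
    nra.
Qed.

(** Since [1 - |z|^2 - conj(z) (1 - z) = 1 - conj(z)], the expression is [c] times a quotient of
    conjugate numbers. *)
Lemma f_extremal_circle (c : R) (z : C) :
  0 < c -> unit_disk z ->
  Cmod (RtoC (1 - Cmod z ^ 2) * pre_schwarzian (f_extremal c) z - RtoC c * Cconj z)%C = c.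
Proof.
  intros hc Hz. rewrite pre_schwarzian_f_extremal by exact Hz.
  assert (Hne := one_minus_neq_0 z Hz).
  replace (RtoC (1 - Cmod z ^ 2) * (RtoC c / (1 - z)) - RtoC c * Cconj z)%C
    with (RtoC c * (Cconj (1 - z) / (1 - z)))%C.
  - rewrite Cmod_mult, Cmod_R, Cmod_div, Cmod_conj by exact Hne.
    rewrite Rabs_pos_eq by lra. field. apply Cmod_gt_0 in Hne. lra.
  - rewrite RtoC_minus, Cmod2_conj.
    replace (Cconj (1 - z)) with (1 - Cconj z)%C by (destruct z; apply injective_projections; simpl; ring).
    field. exact Hne.
Qed.

(** * Sharpness of the constants *)

Lemma continuous_endpoint_ge_0 (g : R -> R) (x : R) :
  Rabs x = 1 -> continuous g x -> (forall t, -1 < t < 1 -> 0 <= g t) -> 0 <= g x.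
Proof.
  intros Hx Hg Hpos. apply Rnot_lt_le. intros Hlt.
  destruct (proj1 (filterlim_locally _ _) Hg (mkposreal (- g x) ltac:(lra))) as [d Hd].
  simpl in Hd. assert (Hd0 := cond_pos d).
  set (e := Rmin d 1 / 2).
  assert (He : 0 < e < d /\ e <= 1 / 2).
  { assert (K := Rmin_pos _ _ Hd0 Rlt_0_1). pose proof (Rmin_l d 1). pose proof (Rmin_r d 1).
    unfold e. lra. }
  assert (Hball : ball x d (x * (1 - e))).
  { change (Rabs (x * (1 - e) - x) < d).
    replace (x * (1 - e) - x) with (- (x * e)) by ring.
    rewrite Rabs_Ropp, Rabs_mult, Hx, Rabs_pos_eq; lra. }
  specialize (Hd _ Hball). change (Rabs (g (x * (1 - e)) - g x) < - g x) in Hd.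
  apply Rabs_def2 in Hd.
  assert (H := Hpos (x * (1 - e))).
  assert (Hx' : x = 1 \/ x = -1) by (unfold Rabs in Hx; destruct (Rcase_abs x); lra).
  destruct Hx' as [-> | ->]; lra.
Qed.

Lemma f_extremal_sharp (c L K : R) :
  0 < c ->
  (forall z, unit_disk z ->
     Re (1 + z * pre_schwarzian (f_extremal c) z)%C
     >= L + K * (1 - Cmod z ^ 2) * Cmod (z * pre_schwarzian (f_extremal c) z)%C ^ 2) ->
  L <= 1 - c / 2 /\ K <= 1 / (2 * c).
Proof.
  intros hc H.
  (* [g] is the difference of the two sides at a real [t], multiplied by [1 - t]; this removes the
     pole and leaves a polynomial. At [t = -1] the term with [K] drops out and [2 - c - 2 L >= 0]
     remains; at [t = 1] the term with [L] drops out and [c - 2 K c^2 >= 0] remains. *)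
  set (g := fun t => (1 - t) + c * t - L * (1 - t) - K * (1 + t) * (c * t) ^ 2).
  assert (Hg : forall t, -1 < t < 1 -> 0 <= g t).
  { intros t Ht. assert (Hz : unit_disk (RtoC t)).
    { unfold unit_disk. rewrite Cmod_R. now apply Rabs_def1. }
    specialize (H _ Hz). rewrite pre_schwarzian_f_extremal in H by exact Hz.
    replace (RtoC t * (RtoC c / (1 - RtoC t)))%C with (RtoC (c * t / (1 - t))) in H.
    - rewrite <- RtoC_plus, re_RtoC, !Cmod_R, !pow2_abs in H.
      apply Rge_le, (Rmult_le_compat_r (1 - t)) in H; [|lra].
      replace ((L + K * (1 - t ^ 2) * (c * t / (1 - t)) ^ 2) * (1 - t))
        with (L * (1 - t) + K * (1 + t) * (c * t) ^ 2) in H by (field; lra).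
      replace ((1 + c * t / (1 - t)) * (1 - t)) with (1 - t + c * t) in H by (field; lra).
      unfold g. lra.
    - rewrite RtoC_div, RtoC_minus, RtoC_mult by lra. field.
      exact (one_minus_neq_0 _ Hz). }
  assert (Hcont : forall x, continuous g x).
  { intros x. apply (ex_derive_continuous (V := R_NormedModule) g). unfold g. auto_derive. auto. }
  assert (G1 := continuous_endpoint_ge_0 g (-1) ltac:(rewrite Rabs_left; lra) (Hcont _) Hg).
  assert (G2 := continuous_endpoint_ge_0 g 1 ltac:(rewrite Rabs_pos_eq; lra) (Hcont _) Hg).
  unfold g in G1, G2. split; [lra|].
  apply Rle_div_r; [lra|].
  apply (Rmult_le_reg_l c); [exact hc|]. lra.
Qed.

Theorem theorem2p1 (c : R) (hc : 0 < c <= 3) :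
  (forall f : C -> C, class_A f -> nonvanishing_deriv f ->
     (class_F c f <->
      (forall z : C, unit_disk z ->
         Re (1 + z * pre_schwarzian f z)%C
         >= 1 - c / 2
            + (1 - Cmod z ^ 2) / (2 * c) * Cmod (z * pre_schwarzian f z)%C ^ 2))
     /\
     (class_F c f <->
      (forall z : C, unit_disk z ->
         Cmod (RtoC (1 - Cmod z ^ 2) * pre_schwarzian f z - RtoC c * Cconj z)%C
         <= c)))
  /\
  (* Sharpness for [f_extremal c], a member of the class.  In the first
     inequality equality is never attained inside the disk, so sharpness means
     that neither of the constants [1 - c / 2] and [1 / (2 * c)] can be
     increased; in the second one equality holds at every point. *)
  class_F c (f_extremal c) /\
  (forall L K : R,
     (forall z : C, unit_disk z ->
        Re (1 + z * pre_schwarzian (f_extremal c) z)%C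
        >= L + K * (1 - Cmod z ^ 2)
               * Cmod (z * pre_schwarzian (f_extremal c) z)%C ^ 2) ->
     L <= 1 - c / 2 /\ K <= 1 / (2 * c)) /\
  (forall z : C, unit_disk z ->
     Cmod (RtoC (1 - Cmod z ^ 2) * pre_schwarzian (f_extremal c) z
           - RtoC c * Cconj z)%C = c).
Proof.
  destruct hc as [hc _].
  split; [intros f HA Hnv; split; split|split; [|split]].
  - intros HF z Hz. apply Cmod_le_Re_ge; [exact hc|exact Hz|].
    now apply class_F_Cmod_le.
  - intros Hii. split; [exact HA|split; [exact Hnv|]].
    intros z Hz. apply Re_ge_Re_gt; auto.
  - intros HF z Hz. apply circle_iff_Cmod_le; [exact hc|exact Hz|].
    now apply class_F_Cmod_le.
  - intros Hiii. split; [exact HA|split; [exact Hnv|]].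
    intros z Hz. apply Re_ge_Re_gt, Cmod_le_Re_ge, circle_iff_Cmod_le; auto.
  - now apply f_extremal_class_F.
  - intros L K. now apply f_extremal_sharp.
  - intros z Hz. now apply f_extremal_circle.
Qed.
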